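(* \textsc{Dominator Coloring} parameterized by the size $k$ of a cluster vertex deletion set of the input graph (given as part of the input) is fixed-parameter tractable: there is an algorithm that solves it in $O^*(2^{O(2^k)})$ time.
   Context: All graphs are finite and simple; $N_G[v]=N_G(v)\cup\{v\}$ is the closed neighborhood. A coloring of $G$ is a map $\chi:V(G)\to C$; it is proper if adjacent vertices get different colors; $|\chi|$ denotes the number of colors used (size of the image). A vertex $v$ dominates a set $S$ if $S\subseteq N_G[v]$. A dominator coloring of $G$ is a proper coloring $\chi$ such that every vertex $v\in V(G)$ dominates some color class $\chi^{-1}(c)$, $c$ in the image of $\chi$. \textsc{Dominator Coloring}: given a graph $G$ and integer $\ell$, decide whether $G$ has a dominator coloring $\chi$ with $|\chi|\le\ell$. A cluster vertex deletion (CVD) set is $M\subseteq V(G)$ such that every connected component of $G-M$ is a clique. $O^*(\cdot)$ hides factors polynomial in the input size. *)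

(* Defs.v *)
From mathcomp Require Import all_boot.
Set Implicit Arguments.
Unset Strict Implicit.
Unset Printing Implicit Defensive.

Record sgraph (T : finType) := SGraph {
  adj :> rel T;
  adj_sym : symmetric adj;
  adj_irrefl : irreflexive adj
}.

Section Graphs.
Variables (T : finType) (G : sgraph T).

Definition closed_nbhd (v : T) : {set T} := [set u | (u == v) || G v u].

Definition dominates (v : T) (S : {set T}) : Prop := S \subset closed_nbhd v.

Definition is_clique (S : {set T}) : Prop :=
  forall x y, x \in S -> y \in S -> x != y -> G x y.

(* Adjacency in G - M; the vertices of M become isolated. *)
Definition del_adj (M : {set T}) : rel T :=
  [rel x y | [&& x \notin M, y \notin M & G x y]].

Definition component (M : {set T}) (x : T) : {set T} :=
  [set y | connect (del_adj M) x y].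

Definition cvd_set (M : {set T}) : Prop :=
  forall x, x \notin M -> is_clique (component M x).

Section Colorings.
Variables (C : finType) (chi : T -> C).

Definition proper_coloring : Prop := forall x y, G x y -> chi x != chi y.

Definition colors_used : {set C} := [set chi x | x : T].

Definition color_class (c : C) : {set T} := [set x | chi x == c].

Definition dominator_coloring : Prop :=
  proper_coloring /\
  forall v, exists2 c, c \in colors_used & dominates v (color_class c).

End Colorings.

Definition dominator_colorable (l : nat) : Prop :=
  exists (C : finType) (chi : T -> C),
    dominator_coloring chi /\ #|colors_used chi| <= l.

End Graphs.

(* Random access machines in the style of Cook and Reckhow, over the natural
   numbers: countably many registers, indirect addressing, a read-only input
   stream, unit cost per instruction.  Addition and truncated subtraction are
   the only arithmetic operations, so the contents of a register have bit
   length linear in the input size plus the number of steps, and running times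
   are polynomially related to those of Turing machines. *)
Inductive instr :=
  | IConst of nat & nat        (* X_i <- c *)
  | IAdd of nat & nat & nat    (* X_i <- X_j + X_k *)
  | ISub of nat & nat & nat    (* X_i <- X_j - X_k *)
  | ILoad of nat & nat         (* X_i <- X_(X_j) *)
  | IStore of nat & nat        (* X_(X_i) <- X_j *)
  | IJump of nat & nat         (* if X_i > 0 then goto m *)
  | IRead of nat.              (* X_i <- next input number, 0 if there is none *)

Definition program := seq instr.

Record config := Config {
  pc : nat;
  reg : nat -> nat;
  input : seq nat
}.

Definition upd (r : nat -> nat) (i v : nat) : nat -> nat :=
  fun j => if j == i then v else r j.

Definition exec (a : instr) (s : config) : config :=
  let: Config q r w := s in
  match a with
  | IConst i c => Config q.+1 (upd r i c) w
  | IAdd i j k => Config q.+1 (upd r i (r j + r k)) w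
  | ISub i j k => Config q.+1 (upd r i (r j - r k)) w
  | ILoad i j => Config q.+1 (upd r i (r (r j))) w
  | IStore i j => Config q.+1 (upd r (r i) (r j)) w
  | IJump i m => Config (if 0 < r i then m else q.+1) r w
  | IRead i => Config q.+1 (upd r i (head 0 w)) (behead w)
  end.

(* The machine halts when the program counter leaves the program; halted
   configurations are fixed points of step. *)
Definition halted (P : program) (s : config) : bool := size P <= pc s.

Definition step (P : program) (s : config) : config :=
  if onth P (pc s) is Some a then exec a s else s.

Definition init (w : seq nat) : config := Config 0 (fun=> 0) w.

Definition run (P : program) (w : seq nat) (t : nat) : config :=
  iter t (step P) (init w).

(* Since halted configurations are fixed points, this says that P halts on w
   after at most t steps, with X_0 <> 0 exactly when Q holds. *)
Definition decides_within (P : program) (w : seq nat) (t : nat) (Q : Prop) :=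
  halted P (run P w t) /\ (0 < reg (run P w t) 0 <-> Q).

Definition bit_length (x : nat) : nat := (trunc_log 2 x).+1.

Definition input_size (w : seq nat) : nat := \sum_(x <- w) bit_length x.

(* The instance (G, M, l): n, l, the indicator vector of M, and the adjacency
   matrix of G row by row. *)
Definition encode (n : nat) (G : sgraph 'I_n) (M : {set 'I_n}) (l : nat) :
    seq nat :=
  [:: n; l] ++ [seq nat_of_bool (x \in M) | x <- enum 'I_n]
            ++ [seq nat_of_bool (G x y) | x <- enum 'I_n, y <- enum 'I_n].

(* Main.v *)
Require Import Defs.
From mathcomp Require Import all_boot zify.
Set Implicit Arguments.
Unset Strict Implicit.
Unset Printing Implicit Defensive.

(* Call a colour named if its class meets M or was chosen as the class dominated
   by some vertex of M; there are at most 2k named colours.  Outside M, a class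
   dominated by a vertex of the clique K either is named, and then consists of
   some vertices of M and at most one vertex, which lies in K, or it is a single
   vertex of K.  So one guesses the colours and the dominated classes of the
   vertices of M, the set of named colours used outside M, the set of those used
   in only one clique, and the number of free colours shared by the cliques; what
   remains is to decide, clique by clique, which named colours to use (a matching
   problem) and whether to spend a private colour.  A dynamic program over the
   cliques does this, remembering the named colours used so far and the number
   of private colours.  There are 2^O(k^2) guesses and 2^O(k) n states.

   The algorithm is written in a language of expressions over the natural numbers
   with a bounded fold, in which sets are numbers and rows of the dynamic program
   are sets of states.  All loops of the main expression are bounded by one number
   N = 2^(2k(k+1)) 2(n+1)^2, hence the running time is polynomial in N. *)

(** * A fold language and its compilation *)

(* Variables are de Bruijn levels.  EBin true is truncated subtraction, and
   EFold x a b iterates b as often as the value of variable x says, starting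
   from a, with the accumulator and the index as two new variables. *)
Inductive expr :=
  | EConst of nat
  | EVar of nat
  | EBin of bool & expr & expr
  | EIf of expr & expr & expr
  | EFold of nat & expr & expr
  | ERead.

Fixpoint den (e : expr) (rho : seq nat) (w : seq nat) : nat * seq nat :=
  match e with
  | EConst c => (c, w)
  | EVar i => (nth 0 rho i, w)
  | EBin sub a b =>
      let p := den a rho w in let q := den b (rcons rho p.1) p.2 in
      (if sub then p.1 - q.1 else p.1 + q.1, q.2)
  | EIf c a b =>
      let p := den c rho w in
      if 0 < p.1 then den a rho p.2 else den b rho p.2
  | EFold x a b =>
      iteri (nth 0 rho x) (fun i p => den b (rcons (rcons rho p.1) i) p.2)
        (den a rho w)
  | ERead => (head 0 w, behead w)
  end.

(* All loops are bounded by the same variable x0, so that the running time is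
   polynomial in its value. *)
Fixpoint wf_expr (x0 : nat) (e : expr) (d : nat) : bool :=
  match e with
  | EConst _ | ERead => true
  | EVar i => i < d
  | EBin _ a b => wf_expr x0 a d && wf_expr x0 b d.+1
  | EIf c a b => [&& wf_expr x0 c d, wf_expr x0 a d & wf_expr x0 b d]
  | EFold x a b => [&& x == x0, x0 < d, wf_expr x0 a d & wf_expr x0 b d.+2]
  end.

Fixpoint clen (e : expr) : nat :=
  match e with
  | EConst _ | ERead => 1
  | EVar _ => 2
  | EBin _ a b => clen a + clen b + 1
  | EIf c a b => clen c + clen b + clen a + 3
  | EFold _ a b => clen a + clen b + 9
  end.

(* The first d registers hold the environment; the result goes to register d.
   Jumps are absolute, whence the offset o of the code. *)
Fixpoint compile (e : expr) (d o : nat) : seq instr :=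
  match e with
  | EConst c => [:: IConst d c]
  | EVar i => [:: IConst d 0; IAdd d d i]
  | EBin sub a b =>
      compile a d o ++ compile b d.+1 (o + clen a)
        ++ [:: if sub then ISub d d d.+1 else IAdd d d d.+1]
  | EIf c a b =>
      let ob := o + clen c + 1 in
      let oa := ob + clen b + 2 in
      compile c d o ++ [:: IJump d oa] ++ compile b d ob
        ++ [:: IConst d.+1 1; IJump d.+1 (oa + clen a)] ++ compile a d oa
  | EFold x a b =>
      let ob := o + clen a + 3 in
      let ot := ob + clen b + 4 in
      compile a d o
        ++ [:: IConst d.+1 0; IConst d.+2 1; IJump d.+2 ot]
        ++ compile b d.+2 ob
        ++ [:: IConst d 0; IAdd d d d.+2; IConst d.+2 1; IAdd d.+1 d.+1 d.+2]
        ++ [:: ISub d.+2 x d.+1; IJump d.+2 ob]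
  | ERead => [:: IRead d]
  end.

Lemma size_compile e d o : size (compile e d o) = clen e.
Proof.
elim: e d o => [||sub a IHa b IHb|c IHc a IHa b IHb|x a IHa b IHb|] //= d o;
  rewrite !size_cat /= ?size_cat /= ?size_cat ?IHa ?IHb ?IHc /=; lia.
Qed.

Definition code_at (P : program) (o : nat) (c : seq instr) :=
  forall i, i < size c -> onth P (o + i) = onth c i.

Lemma code_at_cat P o c1 c2 :
  code_at P o (c1 ++ c2) -> code_at P o c1 /\ code_at P (o + size c1) c2.
Proof.
move=> H; split=> i Hi.
  by rewrite H ?size_cat ?ltn_addr // onth_cat Hi.
rewrite -addnA H ?size_cat ?ltn_add2l // onth_cat.
by rewrite ltnNge leq_addr /= addKn.
Qed.

Lemma code_at_cons P o a c :
  code_at P o (a :: c) -> onth P o = Some a /\ code_at P (o + 1) c.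
Proof.
move=> H; split; first by have := H 0 isT; rewrite addn0.
by move=> i Hi; have := H i.+1 Hi; rewrite -addnA add1n.
Qed.

Definition reaches (P : program) (b : nat) (s s' : config) :=
  exists2 t, t <= b & iter t (step P) s = s'.

Lemma reaches_trans P b1 b2 s1 s2 s3 :
  reaches P b1 s1 s2 -> reaches P b2 s2 s3 -> reaches P (b1 + b2) s1 s3.
Proof.
move=> [t1 H1 E1] [t2 H2 E2]; exists (t2 + t1); first by rewrite addnC leq_add.
by rewrite iterD E1.
Qed.

Lemma reaches_leq P b1 b2 s1 s2 :
  b1 <= b2 -> reaches P b1 s1 s2 -> reaches P b2 s1 s2.
Proof. by move=> Hb [t H E]; exists t => //; apply: leq_trans Hb. Qed.

Lemma reaches_refl P b s : reaches P b s s.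
Proof. by exists 0. Qed.

Lemma reaches_step P b q' q r w a s' :
  onth P q' = Some a -> q' = q -> reaches P b (exec a (Config q r w)) s' ->
  reaches P b.+1 (Config q r w) s'.
Proof.
move=> Ha <- [t Ht E]; exists t.+1 => //.
by rewrite iterSr {2}/step /= Ha.
Qed.

Fixpoint cst (e : expr) : nat :=
  match e with
  | EConst _ | ERead => 1
  | EVar _ => 2
  | EBin _ a b => cst a + cst b + 1
  | EIf c a b => cst c + cst a + cst b + 3
  | EFold _ a b => cst a + cst b + 11
  end.

Fixpoint dep (e : expr) : nat :=
  match e with
  | EConst _ | ERead | EVar _ => 0
  | EBin _ a b => maxn (dep a) (dep b)
  | EIf c a b => maxn (dep c) (maxn (dep a) (dep b))
  | EFold _ a b => maxn (dep a) (dep b).+1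
  end.

Definition agree (r : nat -> nat) (rho : seq nat) :=
  forall i, i < size rho -> r i = nth 0 rho i.

Lemma agree_rcons r r' rho v :
  agree r rho -> (forall i, i < size rho -> r' i = r i) ->
  r' (size rho) = v -> agree r' (rcons rho v).
Proof.
move=> Ha Hr Hv i; rewrite size_rcons ltnS leq_eqVlt nth_rcons.
case/orP=> [/eqP->|Hi]; first by rewrite ltnn eqxx.
by rewrite Hi Hr // Ha.
Qed.

Lemma upd_same r i v : upd r i v i = v.
Proof. by rewrite /upd eqxx. Qed.

Lemma upd_other r i v j : j != i -> upd r i v j = r j.
Proof. by rewrite /upd => /negPf->. Qed.

Lemma compile_correct x0 P B e : forall d o rho w r,
  code_at P o (compile e d o) -> size rho = d -> agree r rho -> wf_expr x0 e d ->
  x0 < d -> nth 0 rho x0 <= B ->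
  exists r', [/\ reaches P (cst e * B.+1 ^ dep e) (Config o r w)
                   (Config (o + clen e) r' (den e rho w).2),
    r' d = (den e rho w).1 & forall i, i < d -> r' i = r i].
Proof.
have pos m : 0 < B.+1 ^ m by rewrite expn_gt0.
have up c m m' : m <= m' -> c * B.+1 ^ m <= c * B.+1 ^ m'.
  by move=> H; rewrite leq_mul2l leq_pexp2l ?orbT.
elim: e => [c|j|sub a IHa b IHb|c IHc a IHa b IHb|x a IHa b IHb|]
  d o rho w r; rewrite /= ?muln1.
- move=> /code_at_cons[Hc _] sz ag _ _ _; exists (upd r d c); split.
  + by rewrite addn1; apply: (reaches_step Hc) => //; apply: reaches_refl.
  + by rewrite upd_same.
  + by move=> i Hi; rewrite upd_other // ltn_eqF.
- move=> /code_at_cons[H1 /code_at_cons[H2 _]] sz ag Hj _ _.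
  eexists; split.
  + rewrite addn1 in H2; rewrite addn2.
    apply: (reaches_step H1) => //; apply: (reaches_step H2) => //.
    exact: reaches_refl.
  + by rewrite upd_same upd_same upd_other ?ltn_eqF // ag ?sz.
  + by move=> i Hi; rewrite !upd_other // ltn_eqF.
- move=> /code_at_cat[Ha /code_at_cat[]]; rewrite !size_compile => Hb.
  move=> /code_at_cons[Hc _] sz ag /andP[wa wb] Hx HB.
  have [r1 [R1 v1 p1]] := IHa d o rho w r Ha sz ag wa Hx HB.
  have ag1 : agree r1 (rcons rho (den a rho w).1).
    by apply: agree_rcons ag _ _; rewrite sz.
  have [|||r2 [R2 v2 p2]] := IHb d.+1 _ (rcons rho (den a rho w).1)
     (den a rho w).2 r1 Hb _ ag1 wb.
  + by rewrite size_rcons sz.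
  + exact: ltnW.
  + by rewrite nth_rcons sz Hx.
  set M := maxn _ _.
  have ma := up (cst a) (dep a) M (leq_maxl _ _).
  have mb := up (cst b) (dep b) M (leq_maxr _ _).
  have mp := pos M.
  exists (upd r2 d (if sub then r2 d - r2 d.+1 else r2 d + r2 d.+1)); split.
  + apply: (@reaches_leq _ (cst a * B.+1 ^ dep a + (cst b * B.+1 ^ dep b + 1))).
      by rewrite !mulnDl; lia.
    apply: (reaches_trans R1); apply: (reaches_trans R2).
    apply: (reaches_step Hc); first lia.
    have -> : o + (clen a + clen b + 1) = (o + clen a + clen b).+1 by lia.
    by case: (sub); apply: reaches_refl.
  + by rewrite upd_same p2 // v1 v2.
  + by move=> i Hi; rewrite upd_other ?ltn_eqF // p2 ?p1 // ltnW.
- move=> /code_at_cat[Hc]; rewrite !size_compile.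
  move=> /code_at_cons[Hj] /code_at_cat[Hb].
  rewrite !size_compile => /code_at_cons[H1 /code_at_cons[H2]].
  rewrite -(addnA _ 1 1) => Ha.
  move=> sz ag /and3P[wc wa wb] Hx HB.
  have [r1 [R1 v1 p1]] := IHc d o rho w r Hc sz ag wc Hx HB.
  have ag1 : agree r1 rho by move=> i Hi; rewrite p1 ?ag // -sz.
  set M := maxn _ _.
  have mc := up (cst c) (dep c) M (leq_maxl _ _).
  have ma := up (cst a) (dep a) M ltac:(rewrite /M; lia).
  have mb := up (cst b) (dep b) M ltac:(rewrite /M; lia).
  have mp := pos M.
  case: ifPn => Hv.
  + have [r2 [R2 v2 p2]] := IHa d _ rho (den c rho w).2 r1 Ha sz ag1 wa Hx HB.
    exists r2; split=> //; last by move=> i Hi; rewrite p2 // p1.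
    apply: (@reaches_leq _ (cst c * B.+1 ^ dep c + (cst a * B.+1 ^ dep a).+1)).
      by rewrite !mulnDl; lia.
    apply: (reaches_trans R1); apply: (reaches_step Hj); first lia.
    rewrite /= v1 Hv.
    have -> : o + (clen c + clen b + clen a + 3) =
      o + clen c + 1 + clen b + 2 + clen a by lia.
    exact: R2.
  + have [r2 [R2 v2 p2]] := IHb d _ rho (den c rho w).2 r1 Hb sz ag1 wb Hx HB.
    exists (upd r2 d.+1 1); split.
    * apply: (@reaches_leq _
        (cst c * B.+1 ^ dep c + (cst b * B.+1 ^ dep b + 2).+1)).
        by rewrite !mulnDl; lia.
      apply: (reaches_trans R1); apply: (reaches_step Hj); first lia.
      rewrite /= v1 (negPf Hv) -[(o + clen c).+1]addn1; apply: (reaches_trans R2).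
      apply: (reaches_step H1); first lia.
      apply: (reaches_step H2); first lia.
      rewrite /= upd_same /=.
      have -> : o + (clen c + clen b + clen a + 3) =
        o + clen c + 1 + clen b + 2 + clen a by lia.
      exact: reaches_refl.
    * by rewrite upd_other ?v2 // neq_ltn leqnn.
    * by move=> i Hi; rewrite upd_other ?p2 ?p1 // ltn_eqF // ltnW.
- move=> /code_at_cat[Ha]; rewrite !size_compile.
  move=> /code_at_cons[H1 /code_at_cons[H2 /code_at_cons[H3]]].
  rewrite -!(addnA _ 1) => /code_at_cat[Hb]; rewrite !size_compile.
  move=> /code_at_cons[H4 /code_at_cons[H5 /code_at_cons[H6 /code_at_cons[H7]]]].
  rewrite -!(addnA _ 1) => /code_at_cons[H8 /code_at_cons[H9 _]].
  move=> sz ag /and4P[/eqP Ex _ wa wb] Hx HB; subst x.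
  have [r1 [R1 v1 p1]] := IHa d o rho w r Ha sz ag wa Hx HB.
  have ag1 : agree r1 rho by move=> i Hi; rewrite p1 ?ag // -sz.
  pose f i (p : nat * seq nat) := den b (rcons (rcons rho p.1) i) p.2.
  rewrite -/f.
  set K := nth 0 rho x0 in HB *.
  set ob := o + clen a + 3 in Hb H3 H9 H4 H5 H6 H7 H8 *.
  set ot := ob + clen b + 4 in H3 *.
  pose T := cst b * B.+1 ^ dep b + 6.
  have loop j : j <= K -> exists r', [/\
      reaches P (3 + j * T) (Config (o + clen a) r1 (den a rho w).2)
        (Config ot r' (iteri j f (den a rho w)).2),
      r' d = (iteri j f (den a rho w)).1, r' d.+1 = j
      & forall i, i < d -> r' i = r i].
    elim: j => [_|j IH Hj].
      exists (upd (upd r1 d.+1 0) d.+2 1); split=> /=.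
      + apply: (reaches_step H1); first lia.
        apply: (reaches_step H2); first lia.
        apply: (reaches_step H3); first lia.
        by rewrite /= upd_same; apply: reaches_refl.
      + by rewrite !upd_other ?v1 //; lia.
      + by rewrite upd_other ?upd_same //; lia.
      + by move=> i Hi; rewrite !upd_other ?p1 //; lia.
    have [r2 [R2 v2 c2 p2]] := IH (ltnW Hj).
    set p := iteri j f _ in R2 v2.
    pose r3 := upd r2 d.+2 (r2 x0 - r2 d.+1).
    have ag3 : agree r3 (rcons (rcons rho p.1) j).
      apply: (@agree_rcons r3).
      + apply: (@agree_rcons r) => //.
        * by move=> i Hi; rewrite /r3 upd_other ?p2 ?sz //; lia.
        * by rewrite /r3 upd_other sz ?v2 //; lia.
      + by [].
      + by rewrite size_rcons sz /r3 upd_other ?c2 //; lia.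
    have [|||r4 [R4 v4 p4]] := IHb d.+2 ob (rcons (rcons rho p.1) j) p.2 r3
       Hb _ ag3 wb.
    + by rewrite !size_rcons sz.
    + by rewrite ltnW // ltnW.
    + by rewrite !nth_rcons !size_rcons sz Hx ltnS (ltnW Hx).
    exists (upd (upd (upd (upd r4 d 0) d (r4 d.+2)) d.+2 1) d.+1 j.+1); split.
    + apply: (@reaches_leq _ (3 + j * T + (cst b * B.+1 ^ dep b + 4).+2)).
        by rewrite /T mulSn; lia.
      apply: (reaches_trans R2).
      apply: (reaches_step H8); first lia.
      rewrite /= -/r3.
      apply: (reaches_step H9); first lia.
      rewrite /= {1}/r3 upd_same p2 // c2 ag -?sz ?sz // -/K subn_gt0 Hj.
      apply: (reaches_trans R4).
      have Ed : ot = (ob + clen b).+4 by rewrite /ot; lia.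
      rewrite Ed.
      apply: (reaches_step H4); first lia.
      apply: (reaches_step H5); first lia.
      apply: (reaches_step H6); first lia.
      apply: (reaches_step H7); first lia.
      rewrite /=.
      have -> : upd r4 d 0 d + upd r4 d 0 d.+2 = r4 d.+2.
        by rewrite upd_same upd_other //; lia.
      set r5 := upd _ d.+2 1.
      have -> : r5 d.+1 + r5 d.+2 = j.+1.
        rewrite /r5 upd_same !upd_other ?p4; try lia.
        by rewrite /r3 upd_other ?c2 ?addn1 //; lia.
      exact: reaches_refl.
    + by do 2 (rewrite upd_other; last lia); rewrite upd_same v4.
    + by rewrite upd_same.
    + by move=> i Hi; rewrite !upd_other ?p4 /r3 ?upd_other ?p2 ; lia.
  have [r2 [R2 v2 c2 p2]] := loop K (leqnn K).
  exists (upd r2 d.+2 (r2 x0 - r2 d.+1)); split.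
  + set M := maxn _ _.
    have ma := up (cst a) (dep a) M (leq_maxl _ _).
    have mb := up (cst b) (dep b).+1 M (leq_maxr _ _).
    have mk := up 1 1 M ltac:(rewrite /M; lia).
    apply: (@reaches_leq _ (cst a * B.+1 ^ dep a + (3 + K * T + 2))).
      have : K * T <= B * T by rewrite leq_mul2r HB orbT.
      have := pos M; have := pos (dep b).
      move: ma mb mk; rewrite /T !mulnDl expnS expn1; nia.
    apply: (reaches_trans R1); apply: (reaches_trans R2).
    have -> : o + (clen a + clen b + 9) = ot.+2 by rewrite /ot /ob; lia.
    apply: (reaches_step H8); first lia.
    apply: (reaches_step H9); first lia.
    rewrite /= upd_same p2 // ag ?sz // -/K c2 subnn /=.
    exact: reaches_refl.
  + by rewrite upd_other ?v2 //; lia.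
  + by move=> i Hi; rewrite upd_other ?p2 //; lia.
- move=> /code_at_cons[Hc _] sz ag _ _ _; exists (upd r d (head 0 w)); split.
  + by rewrite addn1; apply: (reaches_step Hc) => //; apply: reaches_refl.
  + by rewrite upd_same.
  + by move=> i Hi; rewrite upd_other // ltn_eqF.
Qed.

(** * Computable functions *)

(* X is the type of contexts, vs the variables read off a context and nv the
   variable that bounds all loops.  The quantification over register layouts
   pn, pos, d makes weakening trivial, so that no term ever has to be shifted. *)
Definition computes (X : Type) (nv : X -> nat) (vs : seq (X -> nat))
    (F : X -> nat) : Prop :=
  forall pn pos d, pn < d -> all (fun p => p < d) pos -> size pos = size vs ->
  exists2 e, wf_expr pn e d & forall x rho w, size rho = d ->
    nth 0 rho pn = nv x -> [seq nth 0 rho p | p <- pos] = [seq v x | v <- vs] ->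
    den e rho w = (F x, w).

Lemma computes_ext X nv vs (F G : X -> nat) :
  F =1 G -> computes nv vs F -> computes nv vs G.
Proof.
move=> E H pn pos d h1 h2 h3; have [e W D] := H pn pos d h1 h2 h3.
by exists e => // x rho w s1 s2 s3; rewrite (D x) // E.
Qed.

Lemma computes_bound X nv (vs : seq (X -> nat)) : computes nv vs nv.
Proof.
by move=> pn pos d h1 h2 h3; exists (EVar pn) => // x rho w s1 s2 s3 /=; rewrite s2.
Qed.

Lemma computes_var X nv (vs : seq (X -> nat)) j :
  j < size vs -> computes nv vs (nth nv vs j).
Proof.
move=> Hj pn pos d h1 h2 h3; exists (EVar (nth 0 pos j)) => /=.
  by apply: (all_nthP 0 h2); rewrite h3.
move=> x rho w s1 s2 s3; congr pair.
have := congr1 (fun s => nth 0 s j) s3.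
by rewrite (nth_map 0) ?h3 // (nth_map nv).
Qed.

Lemma computes_const X nv (vs : seq (X -> nat)) c :
  computes nv vs (fun=> c).
Proof. by move=> pn pos d h1 h2 h3; exists (EConst c). Qed.

Lemma nth_pos_rcons rho v (pos : seq nat) :
  all (fun p => p < size rho) pos ->
  [seq nth 0 (rcons rho v) p | p <- pos] = [seq nth 0 rho p | p <- pos].
Proof.
by move=> H; apply/eq_in_map => p /(allP H) Hp; rewrite nth_rcons Hp.
Qed.

Lemma computes_bin sub X nv vs (F G : X -> nat) :
  computes nv vs F -> computes nv vs G ->
  computes nv vs (fun x => if sub then F x - G x else F x + G x).
Proof.
move=> HF HG pn pos d h1 h2 h3.
have [a wa da] := HF pn pos d h1 h2 h3.
have h2' : all (fun p => p < d.+1) pos.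
  by apply: sub_all h2 => p; apply: ltnW.
have [b wb db] := HG pn pos d.+1 (ltnW h1) h2' h3.
exists (EBin sub a b); first by rewrite /= wa wb.
move=> x rho w s1 s2 s3 /=; rewrite (da x) //= (db x) // ?size_rcons ?s1 //.
  by rewrite nth_rcons s1 h1.
by rewrite nth_pos_rcons ?s1.
Qed.

Lemma computes_add X nv vs (F G : X -> nat) :
  computes nv vs F -> computes nv vs G -> computes nv vs (fun x => F x + G x).
Proof. exact: (@computes_bin false). Qed.

Lemma computes_sub X nv vs (F G : X -> nat) :
  computes nv vs F -> computes nv vs G -> computes nv vs (fun x => F x - G x).
Proof. exact: (@computes_bin true). Qed.

Lemma computes_succ X nv vs (F : X -> nat) :
  computes nv vs F -> computes nv vs (fun x => (F x).+1).
Proof.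
move=> H; apply: (@computes_ext _ _ _ (fun x => F x + 1)).
  by move=> x; rewrite addn1.
by apply: computes_add => //; apply: computes_const.
Qed.

Notation computesb nv vs P := (computes nv vs (fun x => nat_of_bool (P x))).

Lemma computes_if X nv vs (P : X -> bool) (F G : X -> nat) :
  computesb nv vs P -> computes nv vs F -> computes nv vs G ->
  computes nv vs (fun x => if P x then F x else G x).
Proof.
move=> HP HF HG pn pos d h1 h2 h3.
have [c wc dc] := HP pn pos d h1 h2 h3.
have [a wa da] := HF pn pos d h1 h2 h3.
have [b wb db] := HG pn pos d h1 h2 h3.
exists (EIf c a b); first by rewrite /= wc wa wb.
move=> x rho w s1 s2 s3 /=; rewrite (dc x) //=.
by case: (P x) => /=; [rewrite (da x)|rewrite (db x)].
Qed.

Definition ext_bound (X : Type) (nv : X -> nat) (y : X * nat * nat) := nv y.1.1.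

Definition ext_vars (X : Type) (vs : seq (X -> nat)) :
    seq (X * nat * nat -> nat) :=
  [:: fun y => y.2, fun y => y.1.2 & [seq (fun y => v y.1.1) | v <- vs]].

Lemma computes_fold X nv vs (F : X -> nat) (B : X -> nat -> nat -> nat) :
  computes nv vs F ->
  computes (ext_bound nv) (ext_vars vs) (fun y => B y.1.1 y.1.2 y.2) ->
  computes nv vs (fun x => iteri (nv x) (fun i s => B x i s) (F x)).
Proof.
move=> HF HB pn pos d h1 h2 h3.
have [a wa da] := HF pn pos d h1 h2 h3.
have [|||b wb db] := HB pn [:: d, d.+1 & pos] d.+2.
- by rewrite ltnW // ltnW.
- rewrite /= ltnSn ltnW //=; apply: sub_all h2 => p Hp; lia.
- by rewrite /= size_map h3.
exists (EFold pn a b); first by rewrite /= eqxx h1 wa wb.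
move=> x rho w s1 s2 s3 /=; rewrite (da x) // s2.
elim: (nv x) => //= i ->.
rewrite (db (x, i, iteri i (B x) (F x))) //=.
- by rewrite !size_rcons s1.
- by rewrite !nth_rcons !size_rcons s1 h1 ltnW.
- rewrite !nth_rcons !size_rcons s1 ltnSn ltnn eqxx ltnn eqxx; congr [:: _, _ & _].
  rewrite !nth_pos_rcons ?size_rcons ?s1 // ?s3 -?map_comp //.
  by apply: sub_all h2 => p Hp; lia.
Qed.

Section Closure.
Variables (X : Type) (nv : X -> nat) (vs : seq (X -> nat)).
Implicit Types (P Q : X -> bool) (F G : X -> nat).

Lemma computes_leq F G :
  computes nv vs F -> computes nv vs G -> computesb nv vs (fun x => F x <= G x).
Proof.
move=> HF HG; apply: (@computes_ext _ _ _ (fun x => 1 - (F x - G x))).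
  by move=> x; rewrite -subn_eq0; case: (F x - G x).
by apply: computes_sub; [apply: computes_const | apply: computes_sub].
Qed.

Lemma computes_and P Q :
  computesb nv vs P -> computesb nv vs Q -> computesb nv vs (fun x => P x && Q x).
Proof.
move=> HP HQ.
apply: (@computes_ext _ _ _ (fun x => if P x then nat_of_bool (Q x) else 0)).
  by move=> x; case: (P x).
by apply: computes_if => //; apply: computes_const.
Qed.

Lemma computes_not P : computesb nv vs P -> computesb nv vs (fun x => ~~ P x).
Proof.
move=> HP; apply: (@computes_ext _ _ _ (fun x => 1 - P x)).
  by move=> x; case: (P x).
by apply: computes_sub => //; apply: computes_const.
Qed.

Lemma computes_or P Q :
  computesb nv vs P -> computesb nv vs Q -> computesb nv vs (fun x => P x || Q x).
Proof.
move=> HP HQ.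
apply: (@computes_ext _ _ _ (fun x => if P x then 1 else nat_of_bool (Q x))).
  by move=> x; case: (P x).
by apply: computes_if => //; apply: computes_const.
Qed.

Lemma computes_implb P Q :
  computesb nv vs P -> computesb nv vs Q ->
  computesb nv vs (fun x => P x ==> Q x).
Proof.
move=> HP HQ.
apply: (@computes_ext _ _ _ (fun x => if P x then nat_of_bool (Q x) else 1)).
  by move=> x; case: (P x).
by apply: computes_if => //; apply: computes_const.
Qed.

Lemma computes_eqn F G :
  computes nv vs F -> computes nv vs G -> computesb nv vs (fun x => F x == G x).
Proof.
move=> HF HG.
apply: (@computes_ext _ _ _ (fun x => nat_of_bool ((F x <= G x) && (G x <= F x)))).
  by move=> x; rewrite eqn_leq.
by apply: computes_and; apply: computes_leq.
Qed.

Lemma computes_eqb P Q :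
  computesb nv vs P -> computesb nv vs Q ->
  computesb nv vs (fun x => P x == Q x).
Proof.
move=> HP HQ.
apply: (@computes_ext _ _ _
  (fun x => nat_of_bool (nat_of_bool (P x) == nat_of_bool (Q x)))).
  by move=> x; case: (P x) (Q x) => [] [].
exact: computes_eqn.
Qed.

End Closure.

(* N bounds every loop: these functions have their intended values as long as
   exponents, left factors, dividends and bit positions are at most N.  Bits can
   be read off numbers below 2 ^ N, although no loop is that long, by
   subtracting the powers of two from the top. *)
Definition sumN (N : nat) (f : nat -> nat) := iteri N (fun i s => s + f i) 0.
Definition exN (N : nat) (P : nat -> bool) := 0 < sumN N P.
Definition allN (N : nat) (P : nat -> bool) := ~~ exN N (fun i => ~~ P i).
Definition powN (N e : nat) := iteri N (fun i s => if i < e then s + s else s) 1.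
Definition mulN (N a b : nat) := sumN N (fun i => if i < a then b else 0).
Definition divN (N a b : nat) := sumN N (fun i => nat_of_bool (mulN N i.+1 b <= a)).
Definition lowN (N x p : nat) :=
  iteri N (fun j y =>
    if (p < N - j.+1) && (powN N (N - j.+1) <= y)
    then y - powN N (N - j.+1) else y) x.
Definition bitN (N x p : nat) : bool := powN N p <= lowN N x p.
Definition setN (N : nat) (P : nat -> bool) :=
  sumN N (fun p => if P p then powN N p else 0).
(* The set of the states reachable in T steps, as a number. *)
Definition reachN (N T : nat) (init : nat -> bool)
    (stp : nat -> nat -> nat -> bool) : nat :=
  iteri N (fun t row =>
    if t < T then setN N (fun p' => exN N (fun p => bitN N row p && stp t p p'))
    else row) (setN N init).

Section Binders.
Variables (X : Type) (nv : X -> nat) (vs : seq (X -> nat)).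

Lemma computes_lift (F : X -> nat) :
  computes nv vs F -> computes (ext_bound nv) (ext_vars vs) (fun y => F y.1.1).
Proof.
move=> HF pn [|p0 [|p1 pos]] d h1 //= /and3P[h2 h2' h2''] [h3].
rewrite size_map in h3; have [e We De] := HF pn pos d h1 h2'' h3.
exists e => // y rho w s1 s2 [_ _ s3]; rewrite (De y.1.1) // s3.
by rewrite -map_comp.
Qed.

Lemma computes_acc : computes (ext_bound nv) (ext_vars vs) (fun y => y.2).
Proof. exact: (@computes_var _ (ext_bound nv) (ext_vars vs) 0 isT). Qed.

Lemma computes_idx : computes (ext_bound nv) (ext_vars vs) (fun y => y.1.2).
Proof. exact: (@computes_var _ (ext_bound nv) (ext_vars vs) 1 isT). Qed.

Lemma computes_sum (f : X -> nat -> nat) :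
  computes (ext_bound nv) (ext_vars vs) (fun y => f y.1.1 y.1.2) ->
  computes nv vs (fun x => sumN (nv x) (fun i => f x i)).
Proof.
move=> H; apply: computes_fold; first exact: computes_const.
by apply: computes_add => //; apply: computes_acc.
Qed.

Lemma computes_ex (P : X -> nat -> bool) :
  computesb (ext_bound nv) (ext_vars vs) (fun y => P y.1.1 y.1.2) ->
  computesb nv vs (fun x => exN (nv x) (fun i => P x i)).
Proof.
move=> H; apply: computes_leq; first exact: computes_const.
exact: (computes_sum (f := fun x i => nat_of_bool (P x i))).
Qed.

Lemma computes_all (P : X -> nat -> bool) :
  computesb (ext_bound nv) (ext_vars vs) (fun y => P y.1.1 y.1.2) ->
  computesb nv vs (fun x => allN (nv x) (fun i => P x i)).
Proof.
move=> H; apply: computes_not.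
by apply: (computes_ex (P := fun x i => ~~ P x i)); apply: computes_not.
Qed.

End Binders.

Section Arithmetic.
Variables (X : Type) (nv : X -> nat) (vs : seq (X -> nat)).
Implicit Types F G : X -> nat.

Lemma computes_pow F :
  computes nv vs F -> computes nv vs (fun x => powN (nv x) (F x)).
Proof.
move=> HF; apply: computes_fold; first exact: computes_const.
apply: computes_if.
- by apply: computes_leq; [apply/computes_succ/computes_idx | apply: computes_lift].
- by apply: computes_add; apply: computes_acc.
- exact: computes_acc.
Qed.

Lemma computes_mul F G : computes nv vs F -> computes nv vs G ->
  computes nv vs (fun x => mulN (nv x) (F x) (G x)).
Proof.
move=> HF HG; apply: computes_sum; apply: computes_if.
- by apply: computes_leq; [apply/computes_succ/computes_idx | apply: computes_lift].
- exact: computes_lift.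
- exact: computes_const.
Qed.

End Arithmetic.

Lemma computes_set X nv vs (P : X -> nat -> bool) :
  computesb (ext_bound nv) (ext_vars vs) (fun y => P y.1.1 y.1.2) ->
  computes nv vs (fun x => setN (nv x) (fun i => P x i)).
Proof.
move=> HP; apply: computes_sum; apply: computes_if => //.
- by apply: computes_pow; apply: computes_idx.
- exact: computes_const.
Qed.

Section Bits.
Variables (X : Type) (nv : X -> nat) (vs : seq (X -> nat)).
Implicit Types F G : X -> nat.

Lemma computes_div F G : computes nv vs F -> computes nv vs G ->
  computes nv vs (fun x => divN (nv x) (F x) (G x)).
Proof.
move=> HF HG; apply: computes_sum; apply: computes_leq.
- by apply: computes_mul; [apply/computes_succ/computes_idx | apply: computes_lift].
- exact: computes_lift.
Qed.

Lemma computes_bit F G : computes nv vs F -> computes nv vs G ->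
  computesb nv vs (fun x => bitN (nv x) (F x) (G x)).
Proof.
move=> HF HG; apply: computes_leq; first exact: computes_pow.
have Hd : computes (ext_bound nv) (ext_vars vs) (fun y => nv y.1.1 - y.1.2.+1).
  apply: computes_sub; first exact: computes_bound.
  exact/computes_succ/computes_idx.
apply: computes_fold => //; apply: computes_if.
- apply: computes_and.
    by apply: computes_leq => //; apply/computes_succ/computes_lift.
  by apply: computes_leq; [apply: computes_pow | apply: computes_acc].
- by apply: computes_sub; [apply: computes_acc | apply: computes_pow].
- exact: computes_acc.
Qed.

End Bits.

(** * Values of the bounded operations *)

Lemma sumNE N f : sumN N f = \sum_(i < N) f i.
Proof. by elim: N => [|N IH]; rewrite ?big_ord0 // big_ord_recr /= -IH. Qed.

Lemma exNP N (P : nat -> bool) : reflect (exists2 i, i < N & P i) (exN N P).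
Proof.
rewrite /exN sumNE lt0n sum_nat_eq0 negb_forall.
apply: (iffP existsP) => [[i]|[i Hi Pi]].
  by rewrite /= eqb0 negbK => Pi; exists i.
by exists (Ordinal Hi); rewrite /= Pi.
Qed.

Lemma allNP N (P : nat -> bool) : reflect (forall i, i < N -> P i) (allN N P).
Proof.
apply: (iffP idP) => [/negP H i Hi|H].
  by apply/negPn/negP => Pi; apply: H; apply/exNP; exists i.
by apply/negP => /exNP[i Hi]; rewrite H.
Qed.

Lemma powN_min N e : powN N e = 2 ^ minn N e.
Proof.
rewrite /powN; elim: N => [|m IH] /=; first by rewrite min0n.
rewrite IH; case: ltnP => H.
  by rewrite !(minn_idPl _) // 1?ltnW // expnS mul2n addnn.
by rewrite !(minn_idPr _) // ltnW.
Qed.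

Lemma powNE N e : e <= N -> powN N e = 2 ^ e.
Proof. by move=> He; rewrite powN_min (minn_idPr He). Qed.

Lemma mulNE N a b : a <= N -> mulN N a b = a * b.
Proof.
move=> Ha; rewrite /mulN sumNE -big_mkcond /=.
by rewrite -(big_ord_widen _ (fun=> b) Ha) sum_nat_const card_ord.
Qed.

Lemma divNE N a b : 0 < b -> a <= N -> divN N a b = a %/ b.
Proof.
move=> Hb Ha; rewrite /divN sumNE.
rewrite (eq_bigr (fun i : 'I_N => if i < a %/ b then 1 else 0)); last first.
  by move=> i _; rewrite mulNE // -leq_divRL //; case: ltnP.
rewrite -big_mkcond /= -(big_ord_widen _ (fun=> 1)) ?sum1_card ?card_ord //.
exact: leq_trans (leq_div _ _) Ha.
Qed.

Definition bit (x p : nat) : bool := odd (x %/ 2 ^ p).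

Lemma lowNE N x p m : x < 2 ^ N -> m <= N ->
  exists2 y, iteri m (fun j y =>
    if (p < N - j.+1) && (powN N (N - j.+1) <= y)
    then y - powN N (N - j.+1) else y) x = y
  & y = x %[mod 2 ^ p.+1] /\ y < 2 ^ maxn (N - m) p.+1.
Proof.
move=> Hx; elim: m => [_|m IH Hm].
  exists x => //; split=> //; rewrite subn0; apply: leq_trans Hx _.
  by rewrite leq_pexp2l // leq_maxl.
have [y /= -> [E Hy]] := IH (ltnW Hm).
rewrite powNE ?leq_subr //.
set e := N - m.+1; have Ee : N - m = e.+1 by rewrite /e; lia.
rewrite Ee in Hy.
case: ltnP => /= Hpe; last first.
  exists y => //; split=> //.
  have E1 : maxn e.+1 p.+1 = p.+1 by apply/maxn_idPr.
  by rewrite E1 in Hy; rewrite (maxn_idPr (leqW Hpe)).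
rewrite (maxn_idPl (leqW Hpe)) in Hy; rewrite (maxn_idPl Hpe).
case: leqP => H; last by exists y.
exists (y - 2 ^ e) => //; split.
  rewrite -E -[in RHS](subnK H); apply/esym.
  have -> : 2 ^ e = 2 ^ (e - p.+1) * 2 ^ p.+1 by rewrite -expnD subnK.
  by rewrite addnC modnMDl.
by rewrite expnS mul2n -addnn in Hy; lia.
Qed.

Lemma bitNE N x p : x < 2 ^ N -> bitN N x p = bit x p.
Proof.
move=> Hx; rewrite /bitN /lowN.
have [y -> [E Hy]] := lowNE p Hx (leqnn N).
rewrite subnn max0n in Hy.
have Ey : y = x %% 2 ^ p.+1 by rewrite -E modn_small.
case: (leqP p N) => Hp; last first.
  have Hp' : 2 ^ N <= 2 ^ p by rewrite leq_pexp2l // ltnW.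
  rewrite powN_min (minn_idPl (ltnW Hp)) /bit divn_small ?(leq_trans Hx) //=.
  by apply/negbTE; rewrite -ltnNge Ey (leq_ltn_trans (leq_mod _ _)).
rewrite powNE // /bit {1}(divn_eq x (2 ^ p.+1)) -Ey expnS mulnA.
rewrite divnMDl ?expn_gt0 // oddD muln2 odd_double /=.
have : y %/ 2 ^ p < 2 by rewrite ltn_divLR ?expn_gt0 // -expnS.
by rewrite -[2 ^ p <= y]divn_gt0 ?expn_gt0 //; case: (y %/ 2 ^ p) => [|[|]].
Qed.

Lemma sum_pow_lt m (b : nat -> bool) : \sum_(i < m) b i * 2 ^ i < 2 ^ m.
Proof.
elim: m => [|m IH]; first by rewrite big_ord0.
rewrite big_ord_recr /= expnS mul2n -addnn -addSn leq_add //.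
by case: (b m); rewrite ?mul1n.
Qed.

Lemma bit_sum m (b : nat -> bool) p :
  bit (\sum_(i < m) b i * 2 ^ i) p = (p < m) && b p.
Proof.
elim: m b p => [|m IH] b p; first by rewrite big_ord0 /bit div0n.
rewrite big_ord_recl /= muln1.
rewrite (eq_bigr (fun i : 'I_m => b i.+1 * 2 ^ i * 2)); last first.
  by move=> i _; rewrite /= expnSr mulnA.
rewrite -big_distrl /= /bit.
set S := \sum_(i < m) _.
case: p => [|p]; first by rewrite divn1 oddD muln2 odd_double addbF oddb.
rewrite expnS divnMA addnC divnMDl // (divn_small (m := b 0)) ?addn0; last first.
  by case: (b 0).
by rewrite /S -/(bit _ _) (IH (fun i => b i.+1)).
Qed.

Lemma bitN_sum N m (b : nat -> bool) p : m <= N ->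
  bitN N (\sum_(i < m) b i * 2 ^ i) p = (p < m) && b p.
Proof.
move=> Hm; rewrite bitNE ?bit_sum //; apply: leq_trans (sum_pow_lt m b) _.
by rewrite leq_pexp2l.
Qed.

Lemma bitN_set N (P : nat -> bool) p : bitN N (setN N P) p = (p < N) && P p.
Proof.
rewrite /setN sumNE (eq_bigr (fun i : 'I_N => P i * 2 ^ i)) ?bitN_sum // => i _.
by rewrite powNE 1?ltnW //; case: (P i); rewrite ?mul1n.
Qed.

Lemma mask_exists N m (P : nat -> bool) : 2 ^ m <= N ->
  exists2 h, h < 2 ^ m & forall j, bitN N h j = (j < m) && P j.
Proof.
move=> Hm; exists (\sum_(i < m) P i * 2 ^ i); first exact: sum_pow_lt.
move=> j; apply: bitN_sum; apply: leq_trans Hm; apply: ltnW; exact: ltn_expl.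
Qed.

Lemma reachNP N T (init : nat -> bool) (stp : nat -> nat -> nat -> bool) p : T <= N ->
  reflect (exists s : nat -> nat, [/\ forall t, t <= T -> s t < N,
     init (s 0), s T = p & forall t, t < T -> stp t (s t) (s t.+1)])
    (bitN N (reachN N T init stp) p).
Proof.
move=> HT; rewrite /reachN.
pose f t row := if t < T then
  setN N (fun p' => exN N (fun p => bitN N row p && stp t p p')) else row.
rewrite -/f.
have Ef m s0 : iteri (T + m) f s0 = iteri T f s0.
  elim: m => [|m IH]; first by rewrite addn0.
  by rewrite addnS /= IH /f ltnNge leq_addr.
have -> : iteri N f (setN N init) = iteri T f (setN N init).
  by rewrite -(Ef (N - T)) subnKC.
suff H m : m <= T -> forall p, reflect (exists s : nat -> nat,
    [/\ forall t, t <= m -> s t < N, init (s 0), s m = p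
      & forall t, t < m -> stp t (s t) (s t.+1)])
    (bitN N (iteri m f (setN N init)) p) by exact: H.
elim: m => [|m IH] Hm {}p /=.
  rewrite bitN_set; apply: (iffP andP) => [[Hp Hi]|[s [Hs Hi <- _]]].
    by exists (fun=> p).
  by split=> //; apply: Hs.
rewrite {1}/f Hm bitN_set; apply: (iffP andP) => [[Hp /exNP[p0 Hp0]]|].
  case/andP=> /(IH (ltnW Hm))[s [Hs Hi E St]] Sp.
  exists (fun t => if t <= m then s t else p); split=> //.
  - by move=> t _; case: ifP => // Ht; apply: Hs.
  - by rewrite ltnn.
  - move=> t; rewrite ltnS => Ht; rewrite Ht.
    case: (ltnP t m) => H; first exact: St.
    have -> : t = m by apply/eqP; rewrite eqn_leq Ht.
    by rewrite E.
move=> [s [Hs Hi E St]]; split; first by rewrite -E Hs.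
apply/exNP; exists (s m); first exact: Hs.
rewrite -E St // andbT; apply/(IH (ltnW Hm)).
exists s; split=> // t Ht; first by apply: Hs; apply: leqW.
by apply: St; apply: leqW.
Qed.

(** * The algorithm *)

Section Algorithm.
Variables N n X : nat.

Definition inMN v := bitN N X v.
Definition adjN u v := bitN N X (n + (mulN N u n + v)).
Definition rankN v := sumN N (fun u => nat_of_bool ((u < v) && inMN u)).
Definition slotsN := rankN n + rankN n.
(* A number al encodes a function on M: its value at the r-th vertex of M is the
   number of ones in the r-th block of slotsN bits of al. *)
Definition funN al v := sumN N (fun i =>
  nat_of_bool ((i < slotsN) && bitN N al (mulN N (rankN v) slotsN + i))).
Definition cliqueN x v := ~~ inMN v && ((v == x) || adjN x v).
Definition repN x :=
  ~~ inMN x && allN N (fun u => (u < x) ==> ~~ (~~ inMN u && adjN x u)).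

(* q is the number of named colours, al gives the colours of M and be the classes
   dominated by the vertices of M; uf is the set of named colours used outside
   M, lo the set of those used by at most one clique, and fr is the number of
   the free colours that are not private to a clique. *)
Section Guess.
Variables q al be uf lo fr : nat.

Definition nonemptyN i :=
  bitN N uf i || exN N (fun m => [&& m < n, inMN m & funN al m == i]).

Definition allowedN i v := allN N (fun m => (m < n) && inMN m ==>
  ((funN al m == i) ==> ~~ adjN m v) && ((funN be m == i) ==> adjN m v)).

Definition satN x h := allN N (fun v => (v < n) && cliqueN x v ==>
  exN N (fun i => [&& i < q, nonemptyN i,
    allN N (fun m => [&& m < n, inMN m & funN al m == i] ==> adjN m v) &
    ~~ bitN N uf i || (bitN N lo i && bitN N h i)])).

Definition sizeKN x := sumN N (fun v => nat_of_bool ((v < n) && cliqueN x v)).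

Definition sizeHN h := sumN N (fun i => nat_of_bool ((i < q) && bitN N h i)).

Definition sameN h h' :=
  allN N (fun j => (j < q) ==> (bitN N h' j == bitN N h j)).

Definition emptyN h := allN N (fun j => (j < q) ==> ~~ bitN N h j).

Definition matchstepN x v h h' := sameN h h' || (cliqueN x v &&
  exN N (fun i => [&& i < q, allowedN i v, ~~ bitN N h i &
    allN N (fun j => (j < q) ==> (bitN N h' j == (bitN N h j || (j == i))))])).

Definition matchN x :=
  reachN N n (fun h => emptyN h) (fun v h h' => matchstepN x v h h').

(* A state p of the sweep over the cliques packs the set of named colours used so
   far and the number of cliques that received a private colour. *)
Definition usedN p := divN N p n.+1.
Definition countN p := p - mulN N (usedN p) n.+1.

Definition extendN x p p' h g :=
  [&& g < 2, bitN N (matchN x) h, (g == 1) || satN x h,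
    sizeHN h + g <= sizeKN x, sizeKN x <= sizeHN h + g + fr,
    allN N (fun i => (i < q) && bitN N h i ==>
      ~~ (bitN N lo i && bitN N (usedN p) i)),
    allN N (fun i => (i < q) ==>
      (bitN N (usedN p') i == (bitN N (usedN p) i || bitN N h i))) &
    countN p' == countN p + g].

Definition cliquestepN x p p' :=
  (repN x ==> exN N (fun h => exN N (fun g => extendN x p p' h g))) &&
  (repN x || (p' == p)).

Definition sweepN := reachN N n
  (fun p => emptyN (usedN p) && (countN p == 0))
  (fun x p p' => cliquestepN x p p').

Definition modulatorN := allN N (fun m => (m < n) && inMN m ==>
  [&& funN al m < q, funN be m < q, nonemptyN (funN be m) &
    allN N (fun m' => (m' < n) && inMN m' ==>
      (adjN m m' ==> (funN al m != funN al m')) &&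
      ((funN al m' == funN be m) ==> ((m' == m) || adjN m m')))]).

Definition acceptN l := exN N (fun p => [&& bitN N sweepN p,
  sameN uf (usedN p) & countN p + q + fr <= l]).

End Guess.

Definition mainN l :=
  exN N (fun q => exN N (fun al => exN N (fun be => exN N (fun uf =>
  exN N (fun lo => exN N (fun fr =>
    [&& q <= slotsN, modulatorN q al be uf & acceptN q al be uf lo fr l])))))).

Definition boundN :=
  mulN N N (powN N (mulN N (rankN n) (rankN n) + rankN n +
                    (mulN N (rankN n) (rankN n) + rankN n))).

End Algorithm.

Lemma computes_reach (Z : Type) (nv : Z -> nat) vs T
    (ini : Z -> nat -> bool) (stp : Z -> nat -> nat -> nat -> bool) :
  computes nv vs T ->
  computesb (ext_bound nv) (ext_vars vs) (fun y => ini y.1.1 y.1.2) ->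
  computesb (ext_bound (ext_bound (ext_bound nv)))
    (ext_vars (ext_vars (ext_vars vs)))
    (fun y => stp y.1.1.1.1.1.1 y.1.1.1.1.1.2 y.1.2 y.1.1.1.2) ->
  computes nv vs
    (fun z => reachN (nv z) (T z) (fun h => ini z h) (fun t p p' => stp z t p p')).
Proof.
move=> HT Hi Hs; apply: computes_fold; first exact: computes_set.
apply: computes_if; last exact: computes_acc.
  by apply: computes_leq; [apply/computes_succ/computes_idx | apply: computes_lift].
apply: (@computes_set _ (ext_bound nv) (ext_vars vs) (fun y p' =>
  exN (nv y.1.1) (fun p => bitN (nv y.1.1) y.2 p && stp y.1.1 y.1.2 p p'))).
apply: (@computes_ex _ (ext_bound (ext_bound nv)) (ext_vars (ext_vars vs))
  (fun y p => bitN (nv y.1.1.1.1) y.1.1.2 p && stp y.1.1.1.1 y.1.1.1.2 p y.1.2)).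
apply: computes_and => //.
apply: (@computes_bit _ (ext_bound (ext_bound (ext_bound nv))) _
  (fun y => y.1.1.1.1.2)); last exact: computes_idx.
apply: (@computes_lift _ (ext_bound (ext_bound nv)) (ext_vars (ext_vars vs))
  (fun y => y.1.1.2)).
apply: (@computes_lift _ (ext_bound nv) (ext_vars vs) (fun y => y.2)).
exact: computes_acc.
Qed.

Section Decoding.
Variables (Z : Type) (nv : Z -> nat) (vs : seq (Z -> nat)) (n X : Z -> nat).
Hypotheses (Hn : computes nv vs n) (HX : computes nv vs X).

Lemma computes_adj u v : computes nv vs u -> computes nv vs v ->
  computesb nv vs (fun z => adjN (nv z) (n z) (X z) (u z) (v z)).
Proof.
move=> Hu Hv; apply: computes_bit => //; apply: computes_add => //.
by apply: computes_add => //; apply: computes_mul.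
Qed.

Lemma computes_rank v : computes nv vs v ->
  computes nv vs (fun z => rankN (nv z) (X z) (v z)).
Proof.
move=> Hv; apply: computes_sum; apply: computes_and.
  by apply: computes_leq; [apply/computes_succ/computes_idx | apply: computes_lift].
by apply: computes_bit; [apply: computes_lift | apply: computes_idx].
Qed.

Lemma computes_slots : computes nv vs (fun z => slotsN (nv z) (n z) (X z)).
Proof. by apply: computes_add; apply: computes_rank. Qed.

Lemma computes_fun al v : computes nv vs al -> computes nv vs v ->
  computes nv vs (fun z => funN (nv z) (n z) (X z) (al z) (v z)).
Proof.
move=> Hal Hv; apply: computes_sum; apply: computes_and.
  apply: computes_leq; first exact/computes_succ/computes_idx.
  exact: (computes_lift computes_slots).
apply: computes_bit; first exact: computes_lift.
apply: computes_add; last exact: computes_idx.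
by apply: (@computes_lift _ nv vs (fun z =>
  mulN (nv z) (rankN (nv z) (X z) (v z)) (slotsN (nv z) (n z) (X z))));
  apply: computes_mul; [apply: computes_rank | apply: computes_slots].
Qed.

End Decoding.

Ltac lift_step :=
  lazymatch goal with
  | |- @computes _ (ext_bound ?nv) (ext_vars ?vs) ?F =>
    let G := constr:(fun x => F (x, 0, 0)) in
    let G' := eval cbn [fst snd] in G in
    refine (@computes_lift _ nv vs G' _); cbn [fst snd]
  end.

Ltac comp_step :=
  cbv beta;
  first [ assumption |
  lazymatch goal with
  | |- computes _ _ (fun z => nat_of_bool (andb (@?P z) (@?Q z))) =>
      apply: (computes_and (P := P) (Q := Q))
  | |- computes _ _ (fun z => nat_of_bool (orb (@?P z) (@?Q z))) =>
      apply: (computes_or (P := P) (Q := Q))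
  | |- computes _ _ (fun z => nat_of_bool (implb (@?P z) (@?Q z))) =>
      apply: (computes_implb (P := P) (Q := Q))
  | |- computes _ _ (fun z => nat_of_bool (negb (@?P z))) =>
      apply: (computes_not (P := P))
  | |- computes _ _ (fun z => nat_of_bool (leq (@?P z) (@?Q z))) =>
      apply: (computes_leq (F := P) (G := Q))
  | |- computes _ _ (fun z => nat_of_bool (eq_op (@?P z) (@?Q z))) =>
      first [apply: (computes_eqn (F := P) (G := Q)) |
             apply: (computes_eqb (P := P) (Q := Q))]
  | |- computes _ _ (fun z => nat_of_bool (exN _ (fun i => @?P z i))) =>
      apply: (computes_ex (P := P))
  | |- computes _ _ (fun z => nat_of_bool (allN _ (fun i => @?P z i))) =>
      apply: (computes_all (P := P))
  | |- computes _ _ (fun z => nat_of_bool (bitN _ (@?P z) (@?Q z))) =>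
      apply: (computes_bit (F := P) (G := Q))
  | |- computes _ _ (fun z => nat_of_bool (adjN _ (@?n z) (@?X z) (@?u z) (@?v z))) =>
      apply: (@computes_adj _ _ _ n X _ _ u v)
  | |- computes _ _ (fun z => rankN _ (@?X z) (@?v z)) =>
      apply: (@computes_rank _ _ _ X _ v)
  | |- computes _ _ (fun z => slotsN _ (@?n z) (@?X z)) =>
      apply: (@computes_slots _ _ _ n X)
  | |- computes _ _ (fun z => funN _ (@?n z) (@?X z) (@?al z) (@?v z)) =>
      apply: (@computes_fun _ _ _ n X _ _ al v)
  | |- computes _ _ (fun z => addn (@?P z) (@?Q z)) =>
      apply: (computes_add (F := P) (G := Q))
  | |- computes _ _ (fun z => subn (@?P z) (@?Q z)) =>
      apply: (computes_sub (F := P) (G := Q))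
  | |- computes _ _ (fun z => mulN _ (@?P z) (@?Q z)) =>
      apply: (computes_mul (F := P) (G := Q))
  | |- computes _ _ (fun z => divN _ (@?P z) (@?Q z)) =>
      apply: (computes_div (F := P) (G := Q))
  | |- computes _ _ (fun z => powN _ (@?P z)) =>
      apply: (computes_pow (F := P))
  | |- computes _ _ (fun z => sumN _ (fun i => @?P z i)) =>
      apply: (computes_sum (f := P))
  | |- computes _ _ (fun z => setN _ (fun i => @?P z i)) =>
      apply: (computes_set (P := P))
  | |- computes _ _ (fun z => reachN _ (@?T z) (fun h => @?I z h)
                               (fun t p p' => @?P z t p p')) =>
      apply: (computes_reach (T := T) (ini := I) (stp := P))
  | |- computes _ _ (fun z => S (@?P z)) => apply: (computes_succ (F := P))
  | |- _ => first [exact: computes_idx | exact: computes_acc |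
                   exact: computes_bound | exact: computes_const | lift_step]
  end ].

Ltac comp_solve := repeat comp_step.

Lemma computes_main (Z : Type) (nv : Z -> nat) vs n X l :
  computes nv vs n -> computes nv vs X -> computes nv vs l ->
  computesb nv vs (fun z => mainN (nv z) (n z) (X z) (l z)).
Proof.
move=> *; cbv beta delta [mainN acceptN modulatorN sweepN cliquestepN extendN
  countN usedN matchN matchstepN emptyN sameN sizeHN sizeKN satN allowedN
  nonemptyN repN cliqueN inMN].
by comp_solve.
Qed.

Lemma computes_loopbound (Z : Type) (nv : Z -> nat) vs n X :
  computes nv vs n -> computes nv vs X ->
  computes nv vs (fun z => boundN (nv z) (n z) (X z)).
Proof. by move=> *; rewrite /boundN; comp_solve. Qed.

(** * Dominator colourings as labellings *)

Section Labelling.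
Variables (T : finType) (G : sgraph T) (M : {set T}) (rho : T -> T).

Definition others (q : nat) (lam : T -> nat) (x : T) : {set T} :=
  [set v | [&& v \notin M, rho v == x & q <= lam v]].

Definition singles (sing : T -> bool) : {set T} :=
  [set x | [&& x \notin M, rho x == x & sing x]].

(* The labels below q are the named colours; the vertices with other labels
   are the ones that receive a free colour.  sing marks the cliques, given by
   their representatives, in which one of these colours is used only once in the
   whole graph. *)
Record labelling (l q fr : nat) (lam wit : T -> nat) (sing : T -> bool) : Prop :=
  Labelling {
    lam_proper : forall u v, G u v -> lam u = lam v -> q <= lam u;
    lam_modulator : forall m, m \in M -> lam m < q;
    wit_lt : forall m, m \in M -> wit m < q;
    wit_nonempty : forall m, m \in M -> exists v, lam v = wit m;
    wit_dominated : forall m v, m \in M -> lam v = wit m -> (v == m) || G m v;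
    lam_dominated : forall v, v \notin M -> sing (rho v) \/
      exists i, [/\ i < q, exists u, lam u = i &
        forall u, lam u = i -> (u == v) || G v u];
    others_lb : forall x, x \notin M -> rho x = x -> sing x <= #|others q lam x|;
    others_ub : forall x, x \notin M -> rho x = x ->
      #|others q lam x| <= fr + sing x;
    label_count : q + #|singles sing| + fr <= l }.

Hypothesis rho_notin : forall v, v \notin M -> rho v \notin M.
Hypothesis rhoP : forall u v, u \notin M -> v \notin M ->
  (rho u == rho v) = (u == v) || G u v.
Hypothesis rho_idem : forall v, v \notin M -> rho (rho v) = rho v.

Section ToColoring.
Variables (l q fr : nat) (lam wit : T -> nat) (sing : T -> bool).
Hypothesis L : labelling l q fr lam wit sing.

Let pk x := [pick v in others q lam x].
Let chosen v :=
  [&& v \notin M, q <= lam v, sing (rho v) & pk (rho v) == Some v].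
Let rest x := [set v in others q lam x | ~~ chosen v].
Let col v := if lam v < q then lam v else q + index v (enum (rest (rho v))).
Let chi v : T + 'I_(q + fr).+1 :=
  if chosen v then inl (rho v) else inr (inord (col v)).

Let lam_out v : q <= lam v -> v \notin M.
Proof. by move=> H; apply/negP => /(lam_modulator L); rewrite ltnNge H. Qed.

Let pk_chosen x : x \notin M -> rho x = x -> sing x ->
  exists2 v, v \in others q lam x & pk x = Some v.
Proof.
move=> Hx rx sx; have := others_lb L Hx rx; rewrite sx /pk card_gt0 => /set0Pn[v Hv].
by case: pickP => [v' ?|/(_ v)]; [exists v'|rewrite Hv].
Qed.

Let card_rest x : x \notin M -> rho x = x -> #|rest x| <= fr.
Proof.
move=> Hx rx; have := others_ub L Hx rx; case sx: (sing x); last first.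
  rewrite addn0; apply: leq_trans; apply/subset_leq_card/subsetP => v.
  by rewrite inE => /andP[].
have [v Hv Ev] := pk_chosen Hx rx sx.
rewrite (cardsD1 v) Hv addn1 add1n ltnS; apply: leq_trans.
apply/subset_leq_card/subsetP => u; rewrite !inE => /andP[Hu]; rewrite Hu andbT.
apply: contra => /eqP->; move: Hv; rewrite inE => /and3P[h1 /eqP h2 h3].
by rewrite /chosen h1 h3 h2 sx Ev eqxx.
Qed.

Let rest_mem v : q <= lam v -> ~~ chosen v -> v \in rest (rho v).
Proof. by move=> Hq Hc; rewrite !inE lam_out // Hq Hc eqxx. Qed.

Let col_lt v : ~~ chosen v -> col v < q + fr.
Proof.
move=> Hc; rewrite /col; case: (ltnP (lam v) q) => Hq; first by rewrite ltn_addr.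
rewrite ltn_add2l; apply: (@leq_trans #|rest (rho v)|).
  by rewrite cardE index_mem mem_enum rest_mem.
by apply: card_rest; rewrite ?rho_notin ?rho_idem ?lam_out.
Qed.

Let chi_named v i : i < q -> chi v = inr (inord i) -> lam v = i.
Proof.
move=> Hi; rewrite /chi; case: ifPn => // Hc [].
move/(congr1 (@nat_of_ord _)); rewrite !inordK ?ltnS ?(ltnW (col_lt Hc)) //; last first.
  by rewrite ltnW // ltn_addr.
rewrite /col; case: (ltnP (lam v) q) => // Hq Ei.
by move: Hi; rewrite -Ei ltnNge leq_addr.
Qed.

Let lam_chi v : lam v < q -> chi v = inr (inord (lam v)).
Proof. by move=> H; rewrite /chi /chosen /col leqNgt H andbF. Qed.

Let chosen_eq u v : chosen u -> chosen v -> rho u = rho v -> u = v.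
Proof. by move=> /and4P[_ _ _ /eqP] + /and4P[_ _ _ /eqP] => + + E; rewrite E => -> []. Qed.

Lemma labelling_colorable : dominator_colorable G l.
Proof.
exists (T + 'I_(q + fr).+1)%type, chi; split; last first.
  suff H : #|colors_used chi| <= #|singles sing| + (q + fr).
    by apply: leq_trans H _; apply: leq_trans (label_count L); lia.
  apply: leq_trans (_ : #|(inl @: singles sing) :|: (inr @: [set~ ord_max])| <= _).
    apply/subset_leq_card/subsetP => c /imsetP[v _ ->]; rewrite inE /chi.
    case: ifPn => Hc; apply/orP; [left|right]; apply: imset_f.
      by case/and4P: Hc => h1 h2 h3 h4; rewrite inE rho_notin // rho_idem // eqxx.
    rewrite !inE -val_eqE /= inordK ?ltn_eqF ?col_lt // ltnS ltnW //; exact: col_lt.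
  apply: leq_trans (leq_card_setU _ _) _.
  rewrite !card_imset; try by move=> ? ? [].
  by rewrite cardsC1 card_ord.
split.
  move=> u v Guv; apply/eqP => E.
  case: (ltnP (lam u) q) => Hu.
    move: E; rewrite (lam_chi Hu) => /esym/(chi_named Hu)/esym E.
    by have := lam_proper L Guv E; rewrite leqNgt Hu.
  case: (ltnP (lam v) q) => Hv.
    move: E; rewrite (lam_chi Hv) => /(chi_named Hv) E.
    by move: Hv; rewrite -E ltnNge Hu.
  have uM := lam_out Hu; have vM := lam_out Hv.
  have ruv : rho u = rho v by apply/eqP; rewrite rhoP // Guv orbT.
  suff uv : u = v by move: Guv; rewrite uv adj_irrefl.
  move: E; rewrite /chi; case: ifPn => cu; case: ifPn => cv //.
    by move=> _; apply: chosen_eq.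
  case=> /(congr1 (@nat_of_ord _)).
  rewrite !inordK ?ltnS ?(ltnW (col_lt _)) // /col ltnNge Hu ltnNge Hv /= ruv.
  by move/addnI; apply: (index_inj u); rewrite mem_enum -?ruv ?rest_mem // ruv rest_mem.
move=> v; case: (boolP (v \in M)) => vM.
  have [u Eu] := wit_nonempty L vM; have Hw := wit_lt L vM.
  exists (chi u); first exact: imset_f.
  apply/subsetP => z; rewrite !inE (lam_chi (v := u)) ?Eu // => /eqP/(chi_named Hw).
  exact: (wit_dominated L vM).
case: (lam_dominated L vM) => [sv|[i [Hi [u Eu] Hd]]]; last first.
  exists (chi u); first exact: imset_f.
  apply/subsetP => z; rewrite !inE (lam_chi (v := u)) ?Eu // => /eqP/(chi_named Hi).
  exact: Hd.
have [z Hz Ez] := pk_chosen (rho_notin vM) (rho_idem vM) sv.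
move: Hz; rewrite inE => /and3P[zM /eqP rz qz].
have cz : chosen z by rewrite /chosen zM qz rz sv Ez eqxx.
exists (chi z); first exact: imset_f.
apply/subsetP => y; rewrite !inE /chi cz; case: ifPn => // cy /eqP[] ryz.
have -> : y = z by apply: chosen_eq.
by rewrite eq_sym -rhoP ?rz.
Qed.

End ToColoring.

Section FromColoring.
Variables (C : finType) (chi : T -> C).
Hypothesis dom_chi : dominator_coloring G chi.

Let wc m : C := odflt (chi m)
  [pick c in colors_used chi | color_class chi c \subset closed_nbhd G m].
Let named : {set C} := chi @: M :|: wc @: M.
Let q := #|named|.
Let lam v := index (chi v) (enum named).
Let wit m := index (wc m) (enum named).
Let alone x c := [&& c \in colors_used chi, c \notin named &
  [exists u, [&& u \notin M, rho u == x & color_class chi c == [set u]]]].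
Let sing x := [exists c, alone x c].
Let scol x := odflt (chi x) [pick c | alone x c].

Let wcP m : wc m \in colors_used chi /\ color_class chi (wc m) \subset closed_nbhd G m.
Proof.
have [c cu cd] := dom_chi.2 m; rewrite /wc; case: pickP => [c' /andP[] //|/(_ c)].
by rewrite /= cu cd.
Qed.

Let chi_used v : chi v \in colors_used chi.
Proof. exact: imset_f. Qed.

Let named_used : named \subset colors_used chi.
Proof.
apply/subsetP => c /setUP[] /imsetP[m _ ->]; first exact: chi_used.
by have [] := wcP m.
Qed.

Let lam_lt v : (lam v < q) = (chi v \in named).
Proof. by rewrite /lam /q cardE index_mem mem_enum. Qed.

Let lam_index v c : c \in named -> (lam v == index c (enum named)) = (chi v == c).
Proof.
move=> cn; apply/eqP/eqP => [E|<- //]; apply/eqP.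
rewrite -(nth_index c (s := enum named) (x := c)) ?mem_enum // -E nth_index ?mem_enum //.
by rewrite -lam_lt E /q cardE index_mem mem_enum.
Qed.

Let scolP x : sing x -> alone x (scol x).
Proof. by case/existsP => c Hc; rewrite /scol; case: pickP => // /(_ c); rewrite Hc. Qed.

Let scol_inj : {in singles sing &, injective scol}.
Proof.
move=> x y; rewrite !inE => /and3P[_ _ /scolP/and3P[_ _ /existsP[u]]].
move=> /and3P[_ /eqP <- /eqP Eu] /and3P[_ _ /scolP/and3P[_ _ /existsP[v]]].
move=> /and3P[_ /eqP <- /eqP Ev] E; move: Ev; rewrite -E Eu => /set1_inj -> //.
Qed.

Let S := scol @: singles sing.

Let S_sub : S \subset colors_used chi :\: named.
Proof.
apply/subsetP => c /imsetP[x]; rewrite inE => /and3P[_ _ /scolP/and3P[cu cn _]] ->.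
by rewrite in_setD cn.
Qed.

Let fr := #|colors_used chi| - q - #|singles sing|.

Let count : q + #|singles sing| + fr = #|colors_used chi|.
Proof.
have h1 : #|S| = #|singles sing| by apply: card_in_imset.
have := subset_leq_card S_sub; rewrite h1 cardsD (setIidPr named_used).
have := subset_leq_card named_used; rewrite -/q /fr; lia.
Qed.

Lemma coloring_labelling l : #|colors_used chi| <= l ->
  exists q' fr' lam' wit' sing',
  [/\ q' <= 2 * #|M|, fr' <= #|T| & labelling l q' fr' lam' wit' sing'].
Proof.
move=> Hl; exists q, fr, lam, wit, sing; split.
- rewrite mul2n -addnn /q /named; apply: leq_trans (leq_card_setU _ _) _.
  by apply: leq_add; apply: leq_imset_card.
- apply: (@leq_trans #|colors_used chi|); first by rewrite -count leq_addl.
  exact: leq_imset_card.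
have wn m : m \in M -> wc m \in named.
  by move=> mM; rewrite inE; apply/orP; right; apply: imset_f.
have mn m : m \in M -> chi m \in named.
  by move=> mM; rewrite inE; apply/orP; left; apply: imset_f.
have nM v : chi v \notin named -> v \notin M by apply: contra; apply: mn.
have oth x v : v \in others q lam x -> [/\ v \notin M, rho v = x & chi v \notin named].
  by rewrite inE leqNgt lam_lt => /and3P[? /eqP ? ?].
split.
- move=> u v Guv E; rewrite leqNgt; apply/negP => Hu.
  have := dom_chi.1 _ _ Guv; rewrite eq_sym -lam_index -?lam_lt //.
  by rewrite -E eqxx.
- by move=> m mM; rewrite lam_lt mn.
- by move=> m mM; rewrite /wit /q cardE index_mem mem_enum wn.
- move=> m mM; have [/imsetP[v _ Ev] _] := wcP m.
  by exists v; apply/eqP; rewrite /wit lam_index ?wn // Ev.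
- move=> m v mM /eqP; rewrite /wit lam_index ?wn // => Ev.
  by have [_ /subsetP/(_ v)] := wcP m; rewrite !inE Ev => /(_ isT).
- move=> v vM; have [c cu /subsetP cd] := dom_chi.2 v.
  have [u _ Eu] := imsetP cu.
  case: (boolP (c \in named)) => cn; [right|left].
    exists (index c (enum named)); split.
    + by rewrite /q cardE index_mem mem_enum.
    + by exists u; rewrite /lam Eu.
    + by move=> z /eqP; rewrite lam_index // => Ez; have := cd z; rewrite !inE => ->.
  apply/existsP; exists c; rewrite /alone cu cn /=; apply/existsP; exists u.
  have uM : u \notin M by apply: nM; rewrite -Eu.
  have cl z : chi z = c -> z \notin M /\ rho z = rho v.
    move=> Ez; have zM : z \notin M by apply: nM; rewrite Ez.
    split=> //; apply/esym/eqP; rewrite rhoP // eq_sym.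
    by have := cd z; rewrite !inE Ez eqxx => ->.
  have [_ ru] := cl u (esym Eu).
  rewrite uM ru eqxx /=; apply/eqP/setP => z; rewrite !inE.
  apply/eqP/eqP => [Ez|-> //]; apply/eqP/negPn/negP => zu.
  have [zM rz] := cl z Ez; have : rho z == rho u by rewrite rz ru.
  rewrite rhoP // (negPf zu) /= => /(dom_chi.1 z u).
  by rewrite Ez Eu eqxx.
- move=> x xM rx; case: (boolP (sing x)) => // /scolP/and3P[cu cn /existsP[u]].
  move=> /and3P[uM ru /eqP Eu]; rewrite card_gt0; apply/set0Pn; exists u.
  rewrite inE uM ru leqNgt lam_lt /=.
  suff -> : chi u = scol x by [].
  by apply/eqP; have : u \in [set u] := set11 u; rewrite -Eu inE.
- move=> x xM rx.
  have inj : {in others q lam x &, injective chi}.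
    move=> u v /oth[uM ru _] /oth[vM rv _] E; apply/eqP/negPn/negP => uv.
    have : rho u == rho v by rewrite ru rv.
    by rewrite rhoP // (negPf uv) /= => /(dom_chi.1 u v); rewrite E eqxx.
  rewrite -(card_in_imset inj).
  pose R := colors_used chi :\: named :\: S.
  have cR : #|R| = fr.
    rewrite /R cardsD (setIidPr S_sub) cardsD (setIidPr named_used).
    by rewrite (card_in_imset scol_inj).
  rewrite -cR addnC.
  apply: (@leq_trans #|(if sing x then [set scol x] else set0) :|: R|).
    apply/subset_leq_card/subsetP => c /imsetP[v /oth[vM rv vn] ->].
    rewrite in_setU !(in_setD, vn, chi_used) /= andbT.
    case: (boolP (chi v \in S)) => [/imsetP[y]|]; last by rewrite orbT.
    rewrite inE => /and3P[_ _ sy] Ey; have /and3P[_ _ /existsP[u]] := scolP sy.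
    move=> /and3P[_ /eqP ru /eqP Eu].
    have : v \in [set u] by rewrite -Eu inE Ey.
    rewrite inE => /eqP vu; have xy : x = y by rewrite -rv vu ru.
    by rewrite xy sy inE Ey eqxx.
  apply: leq_trans (leq_card_setU _ _) _; rewrite leq_add2r.
  by case: (sing x); rewrite ?cards1 ?cards0.
- by rewrite count.
Qed.

End FromColoring.

End Labelling.

(** * Correctness of the algorithm *)

Section Representatives.
Variables (n : nat) (G : sgraph 'I_n) (M : {set 'I_n}).
Hypothesis cvdM : cvd_set G M.

Definition in_clique (x v : 'I_n) := (v \notin M) && ((v == x) || G x v).

Definition clique_rep (v : 'I_n) : 'I_n := [arg min_(u < v | in_clique v u) u].

Lemma cvd_trans u v w : u \notin M -> v \notin M -> w \notin M ->
  G u v -> G v w -> (w == u) || G u w.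
Proof.
move=> uM vM wM uv vw; case: eqVneq => //= wu.
have uv' : connect (del_adj G M) u v by apply: connect1; rewrite /del_adj /= uM vM.
apply: (cvdM uM); rewrite ?inE ?connect0 1?eq_sym //.
by apply: connect_trans uv' _; apply: connect1; rewrite /del_adj /= vM wM.
Qed.

Lemma in_clique_refl v : v \notin M -> in_clique v v.
Proof. by move=> vM; rewrite /in_clique vM eqxx. Qed.

Lemma in_clique_trans u v w : u \notin M ->
  in_clique u v -> in_clique v w -> in_clique u w.
Proof.
move=> uM /andP[vM uv] /andP[wM vw]; rewrite /in_clique wM /=.
case/predU1P: uv vw => [->//|uv] /predU1P[->|vw]; first by rewrite uv orbT.
exact: cvd_trans uv vw.
Qed.

Lemma in_clique_sym u v : u \notin M -> in_clique u v -> in_clique v u.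
Proof.
by move=> uM /andP[vM]; rewrite /in_clique uM eq_sym (adj_sym G).
Qed.

Lemma clique_repP v : v \notin M -> in_clique v (clique_rep v) /\
  forall u, in_clique v u -> clique_rep v <= u.
Proof.
by move=> vM; rewrite /clique_rep; case: arg_minnP; rewrite ?in_clique_refl.
Qed.

Lemma clique_rep_notin v : v \notin M -> clique_rep v \notin M.
Proof. by move=> /clique_repP[/andP[]]. Qed.

Lemma clique_rep_eq u v : u \notin M -> v \notin M ->
  (clique_rep u == clique_rep v) = (u == v) || G u v.
Proof.
move=> uM vM; have [ru mu] := clique_repP uM; have [rv mv] := clique_repP vM.
have -> : (u == v) || G u v = in_clique u v by rewrite /in_clique vM eq_sym.
apply/eqP/idP => [E|uv].
  by apply: in_clique_trans ru _ => //; rewrite E; apply: in_clique_sym.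
have vu := in_clique_sym uM uv.
apply/val_inj/eqP; rewrite eqn_leq mu ?mv //.
  exact: in_clique_trans vu ru.
exact: in_clique_trans uv rv.
Qed.

Lemma clique_rep_idem v : v \notin M -> clique_rep (clique_rep v) = clique_rep v.
Proof.
move=> vM; apply/eqP; rewrite clique_rep_eq ?clique_rep_notin //.
have [/(in_clique_sym vM)/andP[_]] := clique_repP vM.
by rewrite eq_sym.
Qed.

Lemma in_clique_rep x v : x \notin M -> clique_rep x = x ->
  in_clique x v = (v \notin M) && (clique_rep v == x).
Proof.
move=> xM rx; rewrite /in_clique; case: (boolP (v \in M)) => //= vM.
by rewrite -{3}rx clique_rep_eq // (adj_sym G).
Qed.

End Representatives.

Lemma rankN_card N X n (M : {set 'I_n}) v : n <= N ->
  (forall u : 'I_n, inMN N X u = (u \in M)) -> v <= n ->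
  rankN N X v = #|[set u in M | u < v]|.
Proof.
move=> nN specM vn; rewrite /rankN sumNE -sum1dep_card [RHS]big_mkcond /=.
have E (u : 'I_n) : (if (u \in M) && (u < v) then 1 else 0) =
   nat_of_bool ((u < v) && inMN N X u) by rewrite specM andbC; case: ifP.
rewrite (eq_bigr _ (fun u _ => E u)).
rewrite [RHS](big_ord_widen N (fun u => nat_of_bool ((u < v) && inMN N X u))) //.
rewrite [RHS]big_mkcond /=; apply: eq_bigr => i _.
case: (ltnP i v) => iv /=; first by rewrite (leq_trans iv vn).
by case: ifP.
Qed.

Lemma rankN_full N X n (M : {set 'I_n}) : n <= N ->
  (forall u : 'I_n, inMN N X u = (u \in M)) -> rankN N X n = #|M|.
Proof.
move=> nN specM; rewrite (rankN_card nN specM) //.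
by apply: eq_card => u; rewrite inE ltn_ord andbT.
Qed.

Section Correctness.
Variables (N n X : nat) (G : sgraph 'I_n) (M : {set 'I_n}).
Hypothesis cvdM : cvd_set G M.
Hypothesis inM_spec : forall v : 'I_n, inMN N X v = (v \in M).
Hypothesis adj_spec : forall u v : 'I_n, adjN N n X u v = G u v.
Let k := #|M|.
Let Q := k + k.
Hypothesis bound_fun : 2 ^ (k * Q) <= N.
Hypothesis bound_state : 2 ^ Q * n.+1 <= N.
Hypothesis bound_two : 2 <= N.

Local Notation rho := (clique_rep G M).
Local Notation bit := (bitN N).

Let bound_mask : 2 ^ Q <= N.
Proof. by apply: leq_trans bound_state; rewrite leq_pmulr. Qed.

Let bound_slots : Q < N.
Proof. by apply: leq_trans bound_mask; apply: ltn_expl. Qed.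

Let bound_n : n < N.
Proof. by apply: leq_trans bound_state; rewrite leq_pmull // expn_gt0. Qed.

Let ordN (v : 'I_n) : v < N := ltn_trans (ltn_ord v) bound_n.

Let rankE v := @rankN_card N X n M v (ltnW bound_n) inM_spec.

Lemma slotsE : slotsN N n X = Q.
Proof.
by rewrite /slotsN (rankN_full (ltnW bound_n) inM_spec).
Qed.

Lemma rank_lt (m : 'I_n) : m \in M -> rankN N X m < k.
Proof.
move=> mM; rewrite (rankE (ltnW (ltn_ord m))) /k; apply: proper_card; apply/properP; split.
  by apply/subsetP => u; rewrite inE => /andP[].
by exists m => //; rewrite inE mM ltnn.
Qed.

Lemma rank_inj : {in M &, injective (fun m : 'I_n => rankN N X m)}.
Proof.
suff lt (u v : 'I_n) : u \in M -> u < v -> rankN N X u < rankN N X v.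
  move=> u v uM vM E; apply/val_inj => /=; case: (ltngtP u v) => // uv.
    by have := lt _ _ uM uv; rewrite E ltnn.
  by have := lt _ _ vM uv; rewrite E ltnn.
move=> uM uv; rewrite !(rankE (ltnW (ltn_ord _))); apply: proper_card; apply/properP; split.
  by apply/subsetP => z; rewrite !inE => /andP[-> /ltn_trans->].
by exists u; rewrite !inE uM ?uv // ltnn.
Qed.

Lemma funN_exists (f : 'I_n -> nat) : (forall m, m \in M -> f m <= Q) ->
  exists2 al, al < N & forall m, m \in M -> funN N n X al m = f m.
Proof.
move=> fQ; have [al Hal bal] := mask_exists (fun p =>
  [exists m in M, (rankN N X m == p %/ Q) && (p %% Q < f m)]) bound_fun.
exists al => [|m mM]; first exact: leq_trans Hal bound_fun.
rewrite /funN slotsE sumNE.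
rewrite (eq_bigr (fun i : 'I_N => if i < f m then 1 else 0)).
  rewrite -big_mkcond -(big_ord_widen _ (fun=> 1)) ?sum1_card ?card_ord //.
  by rewrite (leq_trans (fQ m mM)) // ltnW.
move=> i _; case: (ltnP i Q) => iQ /=; last first.
  by rewrite ltnNge (leq_trans (fQ m mM) iQ).
have Q0 : 0 < Q by apply: leq_ltn_trans iQ.
rewrite mulNE ?(leq_trans (ltnW (rank_lt mM))) //; last first.
  by apply: leq_trans (ltnW bound_slots); rewrite leq_addr.
rewrite bal divnMDl // divn_small // addn0 modnMDl modn_small //.
have -> /= : rankN N X m * Q + i < k * Q.
  apply: (@leq_trans ((rankN N X m).+1 * Q)); last by rewrite leq_mul2r rank_lt ?orbT.
  by rewrite mulSn addnC ltn_add2r.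
suff -> : [exists m0 in M, (rankN N X m0 == rankN N X m) && (i < f m0)] = (i < f m).
  by case: ltnP.
apply/exists_inP/idP => [[m' m'M /andP[/eqP E]]|im]; first by rewrite (rank_inj m'M mM E).
by exists m; rewrite ?eqxx.
Qed.

Lemma repP (x : 'I_n) : reflect (x \notin M /\ rho x = x) (repN N n X x).
Proof.
rewrite /repN inM_spec; apply: (iffP andP) => [[xM /allNP H]|[xM rx]]; split=> //.
  have [rK mr] := clique_repP G xM; apply/val_inj/eqP; rewrite eqn_leq mr ?in_clique_refl //=.
  rewrite leqNgt; apply/negP => lt; have := H _ (ordN (rho x)).
  rewrite lt /= inM_spec adj_spec; move: rK; rewrite /in_clique.
  case/andP=> -> /predU1P[E|->] //.
  by move: lt; rewrite E ltnn.
apply/allNP => u uN; apply/implyP => ux.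
have un : u < n by apply: ltn_trans (ltn_ord x).
rewrite -[u]/(nat_of_ord (Ordinal un)) inM_spec adj_spec; apply/negP => /andP[uM Gxu].
have [_ /(_ (Ordinal un))] := clique_repP G xM.
by rewrite rx /in_clique uM Gxu orbT /= leqNgt ux => /(_ isT).
Qed.

Lemma cliqueE (x v : 'I_n) : cliqueN N n X x v = in_clique G M x v.
Proof. by rewrite /cliqueN inM_spec adj_spec val_eqE. Qed.

Lemma sizeKE (x : 'I_n) : sizeKN N n X x = #|[set v | in_clique G M x v]|.
Proof.
rewrite /sizeKN sumNE -sum1dep_card [RHS]big_mkcond /=.
rewrite (eq_bigr (fun v : 'I_n => nat_of_bool (cliqueN N n X x v))); last first.
  by move=> v _; rewrite cliqueE; case: ifP.
rewrite [RHS](big_ord_widen N (fun v => nat_of_bool (cliqueN N n X x v))) 1?ltnW //.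
by rewrite [RHS]big_mkcond; apply: eq_bigr => i _ /=; case: (ltnP i n).
Qed.

Lemma allN_ord (A B : nat -> bool) :
  reflect (forall v : 'I_n, A v -> B v) (allN N (fun v => (v < n) && A v ==> B v)).
Proof.
apply: (iffP (allNP _ _)) => [H v Av|H v vN].
  by have := H v (ordN v); rewrite ltn_ord Av.
by apply/implyP => /andP[vn Av]; apply: (H (Ordinal vn)).
Qed.

Lemma exN_ord (A : nat -> bool) :
  reflect (exists v : 'I_n, A v) (exN N (fun v => (v < n) && A v)).
Proof.
apply: (iffP (exNP _ _)) => [[v vN /andP[vn Av]]|[v Av]]; first by exists (Ordinal vn).
by exists v; rewrite ?ltn_ord.
Qed.

Section Guess.
Variables (q al be uf lo fr : nat).
Hypothesis qQ : q <= Q.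

Let qN j : j < q -> j < N.
Proof. by move=> jq; apply: ltn_trans (leq_ltn_trans qQ bound_slots); rewrite // ltnS. Qed.

Local Notation a := (funN N n X al).
Local Notation w := (funN N n X be).

Lemma allN_lt (B : nat -> bool) :
  reflect (forall j, j < q -> B j) (allN N (fun j => (j < q) ==> B j)).
Proof.
apply: (iffP (allNP _ _)) => [H j jq|H j _]; last by apply/implyP/H.
by have := H j (qN jq); rewrite jq.
Qed.

Lemma nonemptyP i : reflect (bit uf i \/ exists2 m, m \in M & a m = i)
  (nonemptyN N n X al uf i).
Proof.
apply: (iffP orP) => -[H|H]; [by left| |by left|]; right.
  by case/exN_ord: H => m; rewrite inM_spec => /andP[mM /eqP]; exists m.
by apply/exN_ord; case: H => m mM E; exists m; rewrite inM_spec mM E eqxx.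
Qed.

Lemma allowedP i (v : 'I_n) :
  reflect (forall m, m \in M -> (a m = i -> ~~ G m v) /\ (w m = i -> G m v))
    (allowedN N n X al be i v).
Proof.
apply: (iffP (allN_ord _ _)) => H m; have := H m; rewrite inM_spec adj_spec.
  by move=> + mM => /(_ mM)/andP[/implyP h1 /implyP h2]; split=> /eqP.
move=> + mM => /(_ mM)[h1 h2].
by apply/andP; split; apply/implyP => /eqP.
Qed.

Lemma satP (x : 'I_n) h :
  reflect (forall v, in_clique G M x v -> exists i, [/\ i < q,
      nonemptyN N n X al uf i, forall m, m \in M -> a m = i -> G m v &
      ~~ bit uf i || (bit lo i && bit h i)])
    (satN N n X q al uf lo x h).
Proof.
apply: (iffP (allN_ord _ _)) => H v; have := H v; rewrite cliqueE.
  move=> + vK => /(_ vK)/exNP[i _ /and4P[h1 h2 /allN_ord h3 h4]]; exists i; split=> //.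
  by move=> m mM E; have := h3 m; rewrite inM_spec adj_spec mM E eqxx => /(_ isT).
move=> + vK => /(_ vK)[i [h1 h2 h3 h4]]; apply/exNP; exists i; first exact: qN.
apply/and4P; split=> //; apply/allN_ord => m; rewrite inM_spec adj_spec.
by move=> /andP[mM /eqP]; apply: h3.
Qed.

Lemma modulatorP :
  reflect (forall m, m \in M -> [/\ a m < q, w m < q, nonemptyN N n X al uf (w m) &
     forall m', m' \in M -> (G m m' -> a m <> a m') /\
       (a m' = w m -> (m' == m) || G m m')])
    (modulatorN N n X q al be uf).
Proof.
apply: (iffP (allN_ord _ _)) => H m; have := H m; rewrite inM_spec.
  move=> + mM => /(_ mM)/and4P[h1 h2 h3 /allN_ord h4]; split=> // m' m'M.
  have := h4 m'; rewrite inM_spec adj_spec m'M val_eqE => /(_ isT)/andP[].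
  by move=> /implyP h5 /implyP h6; split=> [/h5/eqP//|/eqP].
move=> + mM => /(_ mM)[h1 h2 h3 h4]; apply/and4P; split=> //.
apply/allN_ord => m'; rewrite inM_spec adj_spec => m'M; have [h5 h6] := h4 m' m'M.
rewrite val_eqE; apply/andP; split; apply/implyP; first by move=> /h5/eqP.
by move=> /eqP; apply: h6.
Qed.

Section Matching.
Variable x : 'I_n.

Definition matching (lab : 'I_n -> nat) h :=
  [/\ forall v, lab v < q -> in_clique G M x v /\ allowedN N n X al be (lab v) v,
      forall u v, lab u < q -> lab u = lab v -> u = v &
      forall j, j < q -> bit h j = [exists v, lab v == j]].

Lemma matchN_sound h : bit (matchN N n X q al be x) h -> exists lab, matching lab h.
Proof.
case/(reachNP _ _ _ (ltnW bound_n)) => s [_ s0 <- st].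
suff H t : t <= n -> exists lab, matching lab (s t) /\ forall v : 'I_n, lab v < q -> v < t.
  by have [lab [H' _]] := H n (leqnn n); exists lab.
elim: t => [_|t IH tn].
  exists (fun=> q); split=> [|v]; last by rewrite ltnn.
  split=> [v|u v|j jq]; rewrite ?ltnn //.
  have /allN_lt/(_ j jq)/negbTE -> := s0.
  by apply/esym/existsP => -[v /eqP E]; rewrite E ltnn in jq.
have [lab [[l1 l2 l3] lt]] := IH (ltnW tn).
case/orP: (st t tn) => [/allN_lt same|/andP[tK /exNP[i _ /and4P[iq ai hi /allN_lt new]]]].
  exists lab; split=> [|v /lt /ltnW //]; split=> // j jq.
  by rewrite (eqP (same j jq)) l3.
pose t' := Ordinal tn; rewrite -[t]/(nat_of_ord t') cliqueE in tK.
exists (fun v => if v == t' then i else lab v); split; last first.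
  by move=> v; case: eqP => [-> //|_ /lt /ltnW].
split.
- by move=> v; case: eqP => [-> //|_]; apply: l1.
- have free v : lab v = i -> False.
    move=> E; move: hi; rewrite l3 // => /negP; apply.
    by apply/existsP; exists v; rewrite E.
  move=> u v; case: eqP => [->|_]; case: eqP => [->|_] //.
  + by move=> _ E; case: (free v).
  + by move=> _ E; case: (free u).
  + exact: l2.
- move=> j jq; rewrite (eqP (new j jq)) l3 //; apply/orP/existsP.
  + case=> [/existsP[v Ev]|/eqP ji]; last by exists t'; rewrite eqxx ji.
    exists v; case: (v =P t') => // E; have := lt v; rewrite (eqP Ev) => /(_ jq).
    by rewrite E ltnn.
  + case=> v; case: (v =P t') => [_ /eqP ->|_ Ev]; [by right; rewrite eqxx|left].
    by apply/existsP; exists v.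
Qed.

Lemma matchN_complete lab h : h < N -> matching lab h ->
  bit (matchN N n X q al be x) h.
Proof.
move=> hN [l1 l2 l3].
have mk t : exists h', h' < N /\ forall j, j < q ->
    bit h' j = [exists v : 'I_n, (v < t) && (lab v == j)].
  have [h' Hh bh] := mask_exists
    (fun j => [exists v : 'I_n, (v < t) && (lab v == j)]) bound_mask.
  exists h'; split=> [|j jq]; first exact: leq_trans Hh bound_mask.
  by rewrite bh (leq_trans jq qQ).
have [s0 Hs0] := fin_all_exists (fun t : 'I_n => mk t).
pose s t := if insub t is Some t' then s0 t' else h.
have sP t : t <= n -> s t < N /\ forall j, j < q ->
    bit (s t) j = [exists v : 'I_n, (v < t) && (lab v == j)].
  move=> tn; rewrite /s; case: insubP => [t' _ <- //|]; rewrite -leqNgt => nt.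
  split=> // j jq; rewrite l3 //; apply: eq_existsb => v.
  by rewrite (leq_trans (ltn_ord v) nt).
apply/(reachNP _ _ _ (ltnW bound_n)); exists s; split.
- by move=> t /sP[].
- apply/allN_lt => j jq; have [_ ->] := sP 0 isT => //.
  by apply/existsP => -[].
- by rewrite /s insubF // ltnn.
move=> t tn; have [_ b1] := sP _ (ltnW tn); have [_ b2] := sP _ tn.
pose t' := Ordinal tn; apply/orP.
case: (ltnP (lab t') q) => lt; [right|left]; last first.
  apply/allN_lt => j jq; rewrite b1 // b2 //; apply/eqP/eq_existsb => v.
  rewrite ltnS leq_eqVlt andb_orl; case: eqP => //= vt.
  have -> : v = t' by apply: val_inj.
  by rewrite orb_idl // => /eqP E; move: lt; rewrite E leqNgt jq.
have [tK ta] := l1 _ lt.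
rewrite -[t]/(nat_of_ord t') cliqueE tK /=; apply/exNP; exists (lab t'); first exact: qN.
apply/and4P; split=> //.
  rewrite b1 //; apply/existsP => -[v /andP[vt /eqP E]].
  by move: vt; rewrite (l2 v t') ?E // ltnn.
apply/allN_lt => j jq; rewrite b1 // b2 //; apply/eqP; apply/existsP/orP.
  case=> v /andP[]; rewrite ltnS leq_eqVlt => /orP[/eqP vt|vt] /eqP E.
    by right; rewrite -E; apply/eqP; congr lab; apply: val_inj.
  by left; apply/existsP; exists v; rewrite vt E eqxx.
case=> [/existsP[v /andP[vt E]]|/eqP ->].
  by exists v; rewrite E ltnS ltnW.
by exists t'; rewrite ltnSn eqxx.
Qed.

Lemma sizeH_matching lab h : matching lab h ->
  sizeHN N q h = #|[set v | lab v < q]|.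
Proof.
move=> [_ l2 l3]; rewrite /sizeHN sumNE -sum1dep_card [RHS]big_mkcond /=.
rewrite (eq_bigr (fun j : 'I_N => \sum_(v < n) nat_of_bool ((lab v < q) && (lab v == j)))).
  rewrite exchange_big /=; apply: eq_bigr => v _; case: ltnP => [lq|_]; last by rewrite big1.
  rewrite (bigD1 (Ordinal (qN lq))) //= eqxx big1 // => j.
  by rewrite -val_eqE /= eq_sym => /negPf->.
move=> j _; case: (ltnP j q) => [jq|qj] /=; last first.
  rewrite big1 // => v _; case: eqP => [->|]; rewrite ?andbF //.
  by rewrite ltnNge qj.
rewrite l3 //; case: existsP => [[v /eqP Ev]|H].
  rewrite (bigD1 v) //= Ev eqxx jq big1 // => u uv; case: eqP; rewrite ?andbF // => Eu.
  by move: uv; rewrite (l2 u v) ?Eu ?Ev ?eqxx // jq.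
rewrite big1 // => v _; case: eqP; rewrite ?andbF // => Ev.
by case: H; exists v; rewrite Ev.
Qed.

End Matching.

Lemma usedE p : p < N -> usedN N n p = p %/ n.+1.
Proof. by move=> pN; rewrite /usedN divNE // ltnW. Qed.

Lemma countE p : p < N -> countN N n p = p %% n.+1.
Proof.
move=> pN; rewrite /countN usedE // mulNE; last first.
  by apply: leq_trans (leq_div _ _) (ltnW pN).
by rewrite {1}(divn_eq p n.+1) addnC addnK.
Qed.

Lemma accept_sound l : modulatorN N n X q al be uf ->
  acceptN N n X q al be uf lo fr l ->
  exists lam sing, labelling G M rho l q fr lam (fun m : 'I_n => w m) sing.
Proof.
move=> /modulatorP Hm /exNP[p pN /and3P[]].
case/(reachNP _ _ _ (ltnW bound_n)) => s [sN /andP[/allN_lt s0 /eqP c0] sE st].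
move=> /allN_lt Huf Hl.
have stepx (x : 'I_n) : exists hg : nat * nat, repN N n X x ->
    extendN N n X q al be uf lo fr x (s x) (s x.+1) hg.1 hg.2.
  case: (boolP (repN N n X x)) => [rx|nx]; last by exists (0, 0).
  have /andP[/implyP/(_ rx)/exNP[h _ /exNP[g _ E]] _] := st x (ltn_ord x).
  by exists (h, g).
have [hg Hhg] := fin_all_exists stepx.
pose h x := (hg x).1; pose g x := (hg x).2.
have labx (x : 'I_n) : exists lab, repN N n X x -> matching x lab (h x).
  case: (boolP (repN N n X x)) => [rx|nx]; last by exists (fun=> 0).
  have /and4P[_ /matchN_sound[lab Hlab] _ _] := Hhg x rx.
  by exists lab.
have [D HD] := fin_all_exists labx.
have used t : t <= n -> forall i, i < q -> bit (usedN N n (s t)) i =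
    [exists x : 'I_n, [&& x < t, repN N n X x & bit (h x) i]].
  elim: t => [_ i iq|t IH tn i iq].
    by rewrite (negbTE (s0 i iq)); apply/esym/existsP => -[].
  pose t' := Ordinal tn; have H0 := st t tn.
  have ext : [exists x : 'I_n, [&& x < t.+1, repN N n X x & bit (h x) i]] =
      bit (usedN N n (s t)) i || (repN N n X t && bit (h t') i).
    rewrite IH ?(ltnW tn) //; apply/existsP/orP.
      case=> x; rewrite ltnS leq_eqVlt => /and3P[/orP[/eqP xt|xt] rx hx].
        by right; rewrite -xt rx; have <- : x = t' by apply: val_inj.
      by left; apply/existsP; exists x; rewrite xt rx.
    case=> [/existsP[x /and3P[xt rx hx]]|/andP[rt ht]].
      by exists x; rewrite ltnS ltnW ?rx.
    by exists t'; rewrite ltnSn rt.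
  rewrite ext; case: (boolP (repN N n X t)) => rt /=.
    have /and4P[_ _ _ /and5P[_ _ _ /allN_lt H _]] := Hhg t' rt.
    by rewrite (eqP (H i iq)).
  move: H0; rewrite /cliquestepN (negPf rt) /= => /eqP ->.
  by rewrite orbF.
have cnt t : t <= n -> countN N n (s t) =
    \sum_(x < n) nat_of_bool [&& x < t, repN N n X x & g x == 1].
  elim: t => [_|t IH tn]; first by rewrite c0 big1.
  pose t' := Ordinal tn; have H0 := st t tn.
  have -> : \sum_(x < n) nat_of_bool [&& x < t.+1, repN N n X x & g x == 1] =
      countN N n (s t) + nat_of_bool (repN N n X t && (g t' == 1)).
    rewrite IH ?(ltnW tn) // (bigD1 t') //= ltnSn /= addnC.
    rewrite [in RHS](bigD1 t') //= ltnn /= add0n; congr (_ + _).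
    by apply: eq_bigr => x; rewrite -val_eqE /= => xt; rewrite ltnS leq_eqVlt (negPf xt).
  case: (boolP (repN N n X t)) => rt /=.
    have /and4P[g2 _ _ /and5P[_ _ _ _ /eqP ->]] := Hhg t' rt.
    by move: g2; rewrite -/(g t'); case: (g t') => [|[|]].
  by move: H0; rewrite /cliquestepN (negPf rt) /= => /eqP ->; rewrite addn0.
pose lam v := if v \in M then a v else D (rho v) v.
have rrep v : v \notin M -> repN N n X (rho v).
  by move=> vM; apply/repP; rewrite clique_rep_notin // clique_rep_idem.
have lamD (x v : 'I_n) : repN N n X x -> D x v < q -> [/\ v \notin M, rho v = x & lam v = D x v].
  move=> rx Dq; have [xM rxE] := repP _ rx.
  have [H1 _ _] := HD x rx; have [] := H1 v Dq.
  rewrite (in_clique_rep cvdM) // => /andP[vM /eqP rv] _.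
  by split=> //; rewrite /lam (negPf vM) rv.
have lamout v : v \notin M -> lam v = D (rho v) v by move=> vM; rewrite /lam (negPf vM).
have hE (x : 'I_n) i : repN N n X x -> i < q ->
    bit (h x) i = [exists v, [&& v \notin M, rho v == x & lam v == i]].
  move=> rx iq; have [_ _ ->] := HD x rx; last by [].
  apply/existsP/existsP => -[v].
    move=> /eqP E; have [|h1 h2 h3] := lamD x v rx; first by rewrite E.
    by exists v; rewrite h1 h2 h3 E !eqxx.
  by case/and3P=> vM /eqP rv; rewrite lamout // rv; exists v.
have ufE i : i < q -> bit uf i = [exists v, (v \notin M) && (lam v == i)].
  move=> iq; rewrite -(eqP (Huf i iq)) -sE used //; apply/existsP/existsP => -[x].
    case/and3P=> _ rx; rewrite hE // => /existsP[v /and3P[vM _ E]].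
    by exists v; rewrite vM.
  case/andP=> vM E; exists (rho x); rewrite ltn_ord rrep // hE ?rrep //.
  by apply/existsP; exists x; rewrite vM eqxx.
have local i (x y : 'I_n) : repN N n X x -> repN N n X y -> i < q -> bit lo i ->
    bit (h x) i -> bit (h y) i -> x = y.
  suff lt (x' y' : 'I_n) : repN N n X x' -> repN N n X y' -> i < q -> bit lo i ->
      bit (h x') i -> bit (h y') i -> ~~ (x' < y').
    move=> rx ry iq li hx hy; apply/val_inj/eqP; rewrite eqn_leq /= !(leqNgt x) !(leqNgt y).
    by rewrite !lt.
  move=> rx ry iq li hx hy; apply/negP => xy.
  have /and4P[_ _ _ /and5P[_ _ /allNP H _ _]] := Hhg y' ry.
  have := H i (qN iq); rewrite iq -/(h y') hy li /= used // 1?ltnW // => /existsP[].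
  by exists x'; rewrite xy rx.
have cardK (x : 'I_n) : repN N n X x ->
    sizeKN N n X x = sizeHN N q (h x) + #|others M rho q lam x|.
  move=> rx; have [xM rxE] := repP _ rx.
  rewrite sizeKE (sizeH_matching (HD x rx)).
  rewrite -(cardsID [set v | D x v < q] [set v | in_clique G M x v]); congr (_ + _).
    apply: eq_card => v; rewrite !inE andb_idl // => /(lamD x v rx)[vM rv _].
    by rewrite (in_clique_rep cvdM) // vM rv eqxx.
  apply: eq_card => v; rewrite !inE (in_clique_rep cvdM) // andbC -leqNgt.
  case: (boolP (v \in M)) => //= vM; case: eqP => //= rv.
  by rewrite lamout // rv.
exists lam, (fun x => g x == 1); split.
- move=> u v Guv E; rewrite leqNgt; apply/negP => uq.
  case: (boolP (u \in M)) => uM; case: (boolP (v \in M)) => vM.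
  + have [_ _ _ /(_ v vM)[/(_ Guv)]] := Hm u uM.
    by move: E; rewrite /lam uM vM.
  + have vq : D (rho v) v < q by rewrite -lamout // -E.
    have [H _ _] := HD _ (rrep v vM); have [_ /allowedP/(_ u uM)[+ _]] := H v vq.
    by rewrite -lamout // -E /lam uM Guv => /(_ erefl).
  + have uq' : D (rho u) u < q by rewrite -lamout.
    have [H _ _] := HD _ (rrep u uM); have [_ /allowedP/(_ v vM)[+ _]] := H u uq'.
    by rewrite -lamout // E /lam vM (adj_sym G) Guv => /(_ erefl).
  + have ruv : rho u = rho v by apply/eqP; rewrite clique_rep_eq // Guv orbT.
    have [_ H _] := HD _ (rrep u uM).
    have uv : u = v by apply: H; rewrite -?lamout // ruv -lamout // -E.
    by move: Guv; rewrite uv (adj_irrefl G).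
- by move=> m mM; have [] := Hm m mM; rewrite /lam mM.
- by move=> m mM; have [] := Hm m mM.
- move=> m mM; have [_ wq /nonemptyP ne _] := Hm m mM; case: ne => [|[m' m'M E]].
    by rewrite ufE // => /existsP[v /andP[_ /eqP E]]; exists v.
  by exists m'; rewrite /lam m'M.
- move=> m v mM E; have [_ wq _ H] := Hm m mM; case: (boolP (v \in M)) => vM.
    by have [_] := H v vM; apply; rewrite -E /lam vM.
  have vq : D (rho v) v < q by rewrite -lamout // E.
  have [H' _ _] := HD _ (rrep v vM); have [_ /allowedP/(_ m mM)[_ H2]] := H' v vq.
  by rewrite H2 ?orbT // -lamout.
- move=> v vM; have /and4P[_ _ + _] := Hhg _ (rrep v vM).
  rewrite -/(g (rho v)) -/(h (rho v)) => /orP[->|/satP Hs]; [by left|right].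
  have vK : in_clique G M (rho v) v.
    by rewrite (in_clique_rep cvdM) ?clique_rep_notin ?clique_rep_idem // vM eqxx.
  have [i [iq ne am loc]] := Hs v vK; exists i; split=> //.
    case/nonemptyP: ne => [|[m' m'M E]]; last by exists m'; rewrite /lam m'M.
    by rewrite ufE // => /existsP[z /andP[_ /eqP E]]; exists z.
  move=> u E; case: (boolP (u \in M)) => uM.
    by rewrite (adj_sym G) am ?orbT //; move: E; rewrite /lam uM.
  have ui : bit uf i by rewrite ufE //; apply/existsP; exists u; rewrite uM E eqxx.
  move: loc; rewrite ui /= => /andP[li hi].
  have hu : bit (h (rho u)) i.
    by rewrite hE ?rrep //; apply/existsP; exists u; rewrite uM E !eqxx.
  have := local i _ _ (rrep u uM) (rrep v vM) iq li hu hi.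
  by move/eqP; rewrite clique_rep_eq // (adj_sym G).
- move=> x xM rxE; have rx : repN N n X x by apply/repP.
  have /and4P[g2 _ _ /andP[H _]] := Hhg x rx.
  move: H g2; rewrite cardK // leq_add2l -/(g x).
  by case: (g x) => [|[|]].
- move=> x xM rxE; have rx : repN N n X x by apply/repP.
  have /and4P[g2 _ _ /and3P[_ H _]] := Hhg x rx.
  move: H g2; rewrite cardK // -addnA leq_add2l -/(g x) addnC.
  by case: (g x) => [|[|]].
- have -> : #|singles M rho (fun x => g x == 1)| = countN N n p.
    rewrite -sE cnt // -sum1dep_card big_mkcond; apply: eq_bigr => x _ /=.
    rewrite ltn_ord /=; case: (repP x) => [[-> ->]|H]; first by rewrite eqxx; case: eqP.
    by case: ifP => // /and3P[xM /eqP rx _]; case: H.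
  by move: Hl; rewrite (addnC q).
Qed.

End Guess.

Lemma main_sound l : mainN N n X l -> dominator_colorable G l.
Proof.
case/exNP=> q _ /exNP[al _ /exNP[be _ /exNP[uf _ /exNP[lo _ /exNP[fr _]]]]].
rewrite slotsE => /and3P[qQ Hm /(accept_sound qQ Hm)[lam [sing L]]].
apply: (labelling_colorable _ _ _ L).
- exact: clique_rep_notin.
- exact: clique_rep_eq.
- exact: clique_rep_idem.
Qed.

Lemma main_complete l q fr lam wit sing : q <= Q -> fr <= n ->
  labelling G M rho l q fr lam wit sing -> mainN N n X l.
Proof.
move=> qQ frn L.
have [al alN Eal] : exists2 al, al < N &
    forall m, m \in M -> funN N n X al m = lam m.
  apply: funN_exists => m mM; apply: leq_trans qQ; apply: ltnW.
  exact: (lam_modulator L).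
have [be beN Ebe] : exists2 be, be < N &
    forall m, m \in M -> funN N n X be m = wit m.
  apply: funN_exists => m mM; apply: leq_trans qQ; apply: ltnW.
  exact: (wit_lt L).
pose mk (P : nat -> bool) := \sum_(i < Q) P i * 2 ^ i.
have mkQ P : mk P < 2 ^ Q by apply: sum_pow_lt.
have mkE P j : j < q -> bit (mk P) j = P j.
  by move=> jq; rewrite bitN_sum ?(leq_trans jq qQ) // ltnW.
pose uf := mk (fun j => [exists v, (v \notin M) && (lam v == j)]).
pose lo := mk (fun j => [forall u, forall v,
  [&& u \notin M, v \notin M, lam u == j & lam v == j] ==> (rho u == rho v)]).
pose h x := mk (fun j => [exists v, [&& v \notin M, rho v == x & lam v == j]]).
pose U t := mk (fun j => [exists v, [&& v \notin M, rho v < t & lam v == j]]).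
pose c t := #|[set x : 'I_n | [&& x < t, repN N n X x & sing x]]|.
have cn t : c t <= n by rewrite -[X in _ <= X]card_ord max_card.
pose s t := U t * n.+1 + c t.
have sN t : s t < N.
  apply: leq_trans bound_state.
  apply: (@leq_trans ((U t).+1 * n.+1)); last by rewrite leq_mul2r mkQ orbT.
  by rewrite /s mulSn (addnC n.+1) ltn_add2l ltnS.
have sU t : usedN N n (s t) = U t.
  by rewrite usedE // divnMDl // divn_small ?addn0 // ltnS.
have sc t : countN N n (s t) = c t.
  by rewrite countE // modnMDl modn_small // ltnS.
have neE i : i < q -> nonemptyN N n X al uf i = [exists v, lam v == i].
  move=> iq; apply/nonemptyP/existsP.
    rewrite mkE //; case=> [/existsP[v /andP[_ E]]|[m mM E]]; first by exists v.
    by exists m; rewrite -Eal // E.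
  case=> v Ev; case: (boolP (v \in M)) => vM; [right|left].
    by exists v; rewrite // Eal // (eqP Ev).
  by rewrite mkE //; apply/existsP; exists v; rewrite vM.
have QN j : j < 2 ^ Q -> j < N by move=> jQ; apply: leq_trans jQ bound_mask.
apply/exNP; exists q; first exact: leq_ltn_trans qQ bound_slots.
apply/exNP; exists al => //; apply/exNP; exists be => //.
apply/exNP; exists uf; first exact: QN (mkQ _).
apply/exNP; exists lo; first exact: QN (mkQ _).
apply/exNP; exists fr; first exact: leq_ltn_trans frn bound_n.
apply/and3P; split; first by rewrite slotsE.
  apply/modulatorP => m mM; rewrite Eal // Ebe //.
  have aq := lam_modulator L mM; have wq := wit_lt L mM; split=> //.
    by rewrite neE //; have [v <-] := wit_nonempty L mM; apply/existsP; exists v.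
  move=> m' m'M; rewrite Eal //; split=> [Gm E|]; last exact: (wit_dominated L mM).
  by have := lam_proper L Gm E; rewrite leqNgt aq.
apply/exNP; exists (s n) => //; apply/and3P; split; last first.
- rewrite sc; move: (label_count L); rewrite (addnC q).
  suff -> : #|singles M rho sing| = c n by [].
  apply: eq_card => x; rewrite !inE ltn_ord andbA /=.
  congr (_ && _); apply/andP/repP => [[? /eqP]|[? ->]]; by rewrite ?eqxx.
- apply/(allN_lt qQ) => j jq; rewrite sU mkE // mkE //; apply/eqP/eq_existsb => v.
  by rewrite ltn_ord.
apply/(reachNP _ _ _ (ltnW bound_n)); exists s; split=> //.
  rewrite sU sc; apply/andP; split; last first.
    by rewrite cards_eq0; apply/eqP/setP => x; rewrite !inE.
  apply/(allN_lt qQ) => j jq; rewrite mkE //; apply/existsP => -[v].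
  by rewrite ltn0 andbF.
move=> t tn; have [x <-] : exists x : 'I_n, nat_of_ord x = t by exists (Ordinal tn).
rewrite /cliquestepN.
have cS : c x.+1 = c x + (repN N n X x && sing x).
  rewrite /c (cardsD1 x) inE ltnSn /= addnC; congr (_ + _).
  apply: eq_card => y; rewrite !inE ltnS leq_eqVlt -val_eqE /=.
  by case: ltngtP.
case: (boolP (repN N n X x)) => rx /=; last first.
  suff -> : s x.+1 = s x by rewrite eqxx.
  rewrite /s cS (negPf rx) addn0; congr (_ * _ + _).
  apply: eq_bigr => j _; congr (nat_of_bool _ * _); apply: eq_existsb => v.
  case: (boolP (v \in M)) => //= vM; congr (_ && _).
  rewrite ltnS leq_eqVlt; case: (nat_of_ord (rho v) =P x) => //= E; case/negP: rx.
  have -> : x = rho v by apply: val_inj.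
  by apply/repP; rewrite clique_rep_notin // clique_rep_idem.
rewrite andbT; apply/exNP; exists (h x); first exact: QN (mkQ _).
apply/exNP; exists (nat_of_bool (sing x)); first by apply: leq_trans bound_two; case: (sing x).
have [xM rxE] := repP _ rx.
pose lab v := if in_clique G M x v then lam v else q.
have Hm : matching q al be x lab (h x).
  split.
  - move=> v; rewrite /lab; case: ifP; rewrite ?ltnn // => vK vq; split=> //.
    have vM : v \notin M by case/andP: vK.
    apply/allowedP => // m mM; rewrite Eal // Ebe //; split=> E.
      by apply/negP => Gmv; have := lam_proper L Gmv E; rewrite E leqNgt vq.
    have := wit_dominated L mM (esym E); case: eqP => // vm.
    by move: vM; rewrite vm mM.
  - move=> u v; rewrite /lab; case: ifP => uK; case: ifP => vK uq E; move: uq;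
      rewrite ?E ?ltnn // => vq.
    move: uK vK; rewrite !(in_clique_rep cvdM) // => /andP[uM /eqP ru] /andP[vM /eqP rv].
    have : rho u == rho v by rewrite ru rv.
    rewrite clique_rep_eq // => /predU1P[//|Guv].
    by have := lam_proper L Guv E; rewrite E leqNgt vq.
  - move=> j jq; rewrite mkE //; apply: eq_existsb => v; rewrite /lab (in_clique_rep cvdM) //.
    rewrite andbA; case: ((v \notin M) && (rho v == x)) => //=; apply/esym/eqP => E.
    by rewrite E ltnn in jq.
have cardK : sizeKN N n X x = sizeHN N q (h x) + #|others M rho q lam x|.
  rewrite sizeKE // (sizeH_matching qQ Hm).
  rewrite -(cardsID [set v | lab v < q] [set v | in_clique G M x v]); congr (_ + _).
    apply: eq_card => v; rewrite !inE /lab; case: ifP => //= _; by rewrite ltnn.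
  apply: eq_card => v; rewrite !inE /lab (in_clique_rep cvdM) // -leqNgt.
  by case: (v \in M) => /=; rewrite ?andbF //; case: eqP; rewrite ?andbF ?andbT.
apply/and4P; split.
- by case: (sing x).
- by apply: matchN_complete Hm => //; apply: QN (mkQ _).
- case: (boolP (sing x)) => //= nsx; apply/satP => // v vK.
  move: (vK); rewrite (in_clique_rep cvdM) // => /andP[vM /eqP rv].
  case: (lam_dominated L vM) => [|[i [iq [u Eu] Hd]]]; first by rewrite rv (negPf nsx).
  exists i; split=> //.
  + by rewrite neE //; apply/existsP; exists u; rewrite Eu.
  + move=> m mM; rewrite Eal // => /Hd /predU1P[mv|]; last by rewrite (adj_sym G).
    by move: vM; rewrite -mv mM.
  + rewrite !mkE //; case: existsP => //= -[z /andP[zM /eqP Ez]].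
    have same y : y \notin M -> lam y = i -> rho y = x.
      move=> yM /Hd H; apply/eqP; rewrite -rv clique_rep_eq //.
      by rewrite (adj_sym G).
    apply/andP; split.
      apply/forallP => u1; apply/forallP => u2; apply/implyP.
      by move=> /and4P[h1 h2 /eqP h3 /eqP h4]; rewrite !same.
    by apply/existsP; exists z; rewrite zM same // Ez !eqxx.
apply/and5P; split.
- by rewrite cardK leq_add2l; apply: (others_lb L).
- by rewrite cardK -addnA leq_add2l addnC; apply: (others_ub L).
- apply/allNP => i _; apply/implyP => /andP[iq]; rewrite sU !mkE // => /existsP[v].
  move=> /and3P[vM /eqP rv Ev]; apply/negP => /andP[/forallP H /existsP[u]].
  move=> /and3P[uM ru Eu]; have /forallP/(_ v) := H u.
  rewrite uM vM Eu Ev /= rv => /eqP E.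
  by move: ru; rewrite E ltnn.
- apply/(allN_lt qQ) => i iq; rewrite !sU !mkE //.
  apply/eqP; apply/existsP/orP.
    case=> v /and3P[vM]; rewrite ltnS leq_eqVlt => /orP[rv|rv] Ev; [right|left];
      apply/existsP; exists v; rewrite vM Ev ?rv //=.
    by rewrite -val_eqE /= rv.
  case=> /existsP[v /and3P[vM rv Ev]]; exists v; rewrite vM Ev andbT /=.
    by rewrite ltnS ltnW.
  by rewrite (eqP rv) ltnSn.
- by rewrite !sc cS rx.
Qed.

Lemma main_correct l : mainN N n X l <-> dominator_colorable G l.
Proof.
split; first exact: main_sound.
case=> C [chi [dom Hl]].
have [q [fr [lam [wit [sing [qk frn L]]]]]] :=
  coloring_labelling (clique_rep_eq cvdM) dom Hl.
apply: (main_complete _ _ L); last by rewrite -[n]card_ord.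
by rewrite /Q addnn -mul2n.
Qed.

End Correctness.

(** * The machine *)

Lemma nth_allpairs (S T R : Type) (f : S -> T -> R) s t x0 y0 z0 i j :
  i < size s -> j < size t ->
  nth z0 [seq f x y | x <- s, y <- t] (i * size t + j) = f (nth x0 s i) (nth y0 t j).
Proof.
move=> + jt; elim: s i => [//|x s IH] [|i] /= si; rewrite nth_cat size_map.
  by rewrite jt (nth_map y0).
by rewrite mulSn -addnA ltnNge leq_addr addKn IH.
Qed.

Section Encoding.
Variables (n : nat) (G : sgraph 'I_n) (M : {set 'I_n}) (l : nat).

Definition bits_of : seq bool :=
  [seq x \in M | x <- enum 'I_n] ++ [seq G x y | x <- enum 'I_n, y <- enum 'I_n].

Lemma encodeE : encode G M l = [:: n, l & [seq nat_of_bool b | b <- bits_of]].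
Proof. by rewrite /encode /bits_of map_cat map_allpairs -map_comp. Qed.

Lemma size_bits : size bits_of = n + n * n.
Proof. by rewrite size_cat size_map size_allpairs size_enum_ord. Qed.

Lemma bits_modulator (v : 'I_n) : nth false bits_of v = (v \in M).
Proof.
rewrite nth_cat size_map size_enum_ord ltn_ord (nth_map v) ?size_enum_ord //.
by rewrite nth_ord_enum.
Qed.

Lemma bits_adj (u v : 'I_n) : nth false bits_of (n + (u * n + v)) = G u v.
Proof.
rewrite nth_cat size_map size_enum_ord ltnNge leq_addr addKn /=.
have := @nth_allpairs _ _ _ (fun x y => G x y) (enum 'I_n) (enum 'I_n) u v false u v.
by rewrite !size_enum_ord !nth_ord_enum => ->.
Qed.

Lemma input_size_encode : n.+1 <= input_size (encode G M l).
Proof.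
have H (s : seq nat) : size s <= input_size s.
  by rewrite -sum1_size; apply: leq_sum.
apply: leq_trans (H _); rewrite encodeE /= size_map size_bits; lia.
Qed.

End Encoding.

Definition square_bound (n : nat) :=
  (mulN n n n + n + n + 1) + (mulN n n n + n + n + 1).

Lemma square_boundE n : square_bound n = 2 * n.+1 ^ 2.
Proof. rewrite /square_bound mulNE //; lia. Qed.

Definition read_bits : expr :=
  EFold 3 (EConst 0) (EBin false (EVar 4)
    (EFold 3 ERead (EIf (EBin true (EVar 5) (EVar 8))
                        (EBin false (EVar 7) (EVar 7)) (EVar 7)))).

Lemma den_read_bits d0 n l b w :
  (den read_bits [:: d0; n; l; b] w).1 = \sum_(i < b) nth 0 w i * 2 ^ i.
Proof.
rewrite /=.
have dbl i v (w' : seq nat) m : iteri m (fun j (p : nat * seq nat) =>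
   if 0 < i - j then (p.1 + p.1, p.2) else (p.1, p.2)) (v, w') = (v * 2 ^ minn m i, w').
  elim: m => [|m IH] /=; first by rewrite min0n muln1.
  rewrite IH /= subn_gt0; case: ltnP => H.
    by rewrite !(minn_idPl _) // 1?ltnW // expnS mulnCA mul2n addnn.
  by rewrite !(minn_idPr _) // ltnW.
set f := (X in iteri b X).
suff H m : m <= b -> iteri m f (0, w) = (\sum_(i < m) nth 0 w i * 2 ^ i, drop m w).
  by rewrite H.
elim: m => [_|m IH mb] /=; first by rewrite big_ord0 drop0.
rewrite IH ?(ltnW mb) // {1}/f /= dbl /= big_ord_recr /= (minn_idPr (ltnW mb)).
by rewrite -nth0 nth_drop addn0 -drop1 drop_drop add1n.
Qed.

Definition runs (P : program) (b o : nat) (rho w : seq nat)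
    (o' : nat) (rho' w' : seq nat) :=
  forall r, agree r rho -> exists2 r', agree r' rho' &
    reaches P b (Config o r w) (Config o' r' w').

Lemma runs_expr x0 P B e o rho w :
  code_at P o (compile e (size rho) o) -> wf_expr x0 e (size rho) ->
  x0 < size rho -> nth 0 rho x0 <= B ->
  runs P (cst e * B.+1 ^ dep e) o rho w (o + clen e)
    (rcons rho (den e rho w).1) (den e rho w).2.
Proof.
move=> Hc Hw Hx HB r ag.
have [r' [R v p]] := compile_correct w Hc erefl ag Hw Hx HB.
by exists r' => //; apply: agree_rcons ag _ v.
Qed.

Lemma runs_trans P b1 b2 o1 rho1 w1 o2 rho2 w2 o3 rho3 w3 :
  runs P b1 o1 rho1 w1 o2 rho2 w2 -> runs P b2 o2 rho2 w2 o3 rho3 w3 ->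
  runs P (b1 + b2) o1 rho1 w1 o3 rho3 w3.
Proof.
move=> H1 H2 r1 a1; have [r2 a2 R1] := H1 r1 a1; have [r3 a3 R2] := H2 r2 a2.
by exists r3 => //; apply: reaches_trans R1 R2.
Qed.

(* Each expression leaves its value in the first register not yet in use. *)
Fixpoint compile_seq (es : seq expr) (d o : nat) : seq instr :=
  if es is e :: es' then compile e d o ++ compile_seq es' d.+1 (o + clen e) else [::].

Fixpoint run_seq (es : seq expr) (rho w : seq nat) : seq nat * seq nat :=
  if es is e :: es' then
    let p := den e rho w in run_seq es' (rcons rho p.1) p.2
  else (rho, w).

Fixpoint wf_exprs (B : nat) (es : seq (nat * expr)) (rho w : seq nat) : bool :=
  if es is (x, e) :: es' then
    [&& wf_expr x e (size rho), x < size rho, nth 0 rho x <= B &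
      wf_exprs B es' (rcons rho (den e rho w).1) (den e rho w).2]
  else true.

Lemma runs_seq P B xes : forall o rho w,
  let es := [seq xe.2 | xe <- xes] in
  code_at P o (compile_seq es (size rho) o) -> wf_exprs B xes rho w ->
  runs P ((\sum_(e <- es) cst e) * B.+1 ^ (\max_(e <- es) dep e)) o rho w
    (o + size (compile_seq es (size rho) o)) (run_seq es rho w).1 (run_seq es rho w).2.
Proof.
elim: xes => [|[x e] xes IH] o rho w /=.
  by move=> _ _ r ag; rewrite addn0; exists r => //; apply: reaches_refl.
move=> /code_at_cat[H1]; rewrite size_compile => H2 /and4P[h1 h2 h3 h4].
have E1 := runs_expr w H1 h1 h2 h3.
have := IH (o + clen e) (rcons rho (den e rho w).1) (den e rho w).2 _ h4.
rewrite size_rcons => /(_ H2) E2.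
move=> r ag; have [r' ag' R] := runs_trans E1 E2 ag.
exists r' => //; rewrite size_cat size_compile addnA; apply: reaches_leq R.
rewrite !big_cons mulnDl; set m := maxn _ _; apply: leq_add; rewrite leq_mul2l.
  by rewrite leq_pexp2l ?leq_maxl ?orbT.
by rewrite leq_pexp2l ?leq_maxr ?orbT.
Qed.

Lemma polynomial_bound C D k n S : n.+1 <= S ->
  C * (2 * n.+1 ^ 2 * 2 ^ ((k * k + k) + (k * k + k))).+1 ^ D <=
  2 ^ ((C + 8 * D) * 2 ^ k) * S ^ (2 * D).
Proof.
move=> nS.
have kk : k * k + k + 1 <= 4 * 2 ^ k.
  elim: k => [//|k IH]; have := ltn_expl k (ltnSn 1); rewrite expnS; nia.
set B := 2 * _ * _.
have B1 : B.+1 <= 2 ^ (8 * 2 ^ k) * S ^ 2.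
  have B0 : 0 < B by rewrite /B !muln_gt0 !expn_gt0.
  apply: (@leq_trans (2 * B)); first by lia.
  have -> : 2 * B = 2 ^ (k * k + k + (k * k + k)).+2 * n.+1 ^ 2.
    by rewrite /B 2!(expnS 2); move: (2 ^ _) (n.+1 ^ 2) => u v; lia.
  by apply: leq_mul; [rewrite leq_pexp2l //; lia | rewrite leq_exp2r].
apply: (@leq_trans (2 ^ C * (2 ^ (8 * 2 ^ k) * S ^ 2) ^ D)).
  apply: leq_mul; first by apply: ltnW; apply: ltn_expl.
  by case: D => // D; rewrite leq_exp2r.
rewrite expnMn -!expnM mulnA -expnD leq_mul2r leq_pexp2l ?orbT //.
have : 0 < 2 ^ k by rewrite expn_gt0.
nia.
Qed.

Theorem theorem13 :
  exists (P : program) (c d : nat),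
    forall (n : nat) (G : sgraph 'I_n) (M : {set 'I_n}) (k l : nat),
      cvd_set G M -> #|M| = k ->
      decides_within P (encode G M l)
        (2 ^ (c * 2 ^ k) * input_size (encode G M l) ^ d)
        (dominator_colorable G l).
Proof.
have [e3 w3 d3] : exists2 e3, wf_expr 1 e3 3 & forall n rho w, size rho = 3 ->
    nth 0 rho 1 = n -> den e3 rho w = (square_bound n, w).
  have H : computes (fun n : nat => n) [::] square_bound.
    by rewrite /square_bound; comp_solve.
  have [e We De] := H 1 [::] 3 isT isT erefl.
  by exists e => // n rho w s1 s2; rewrite (De n).
have [e4 w4 d4] : exists2 e4, wf_expr 3 e4 4 & forall n l b w,
    (den e4 [:: 0; n; l; b] w).1 = \sum_(i < b) nth 0 w i * 2 ^ i.
  by exists read_bits => // n l b w; apply: den_read_bits.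
have [e5 w5 d5] : exists2 e5, wf_expr 3 e5 5 & forall n l b x w,
    den e5 [:: 0; n; l; b; x] w = (boundN b n x, w).
  pose nv (z : nat * nat * nat) := z.1.1.
  pose vs := [:: fun z : nat * nat * nat => z.1.2; fun z => z.2].
  have H : computes nv vs (fun z => boundN z.1.1 z.1.2 z.2).
    apply: (@computes_loopbound _ nv vs (fun z => z.1.2) (fun z => z.2)).
    + exact: (@computes_var _ nv vs 0).
    + exact: (@computes_var _ nv vs 1).
  have [e We De] := H 3 [:: 1; 4] 5 isT isT erefl.
  by exists e => // n l b x w; rewrite (De (b, n, x)).
have [e6 w6 d6] : exists2 e6, wf_expr 5 e6 6 & forall n l b x N w,
    den e6 [:: 0; n; l; b; x; N] w = (nat_of_bool (mainN N n x l), w).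
  pose nv (z : nat * nat * nat * nat) := z.1.1.1.
  pose vs := [:: fun z : nat * nat * nat * nat => z.1.1.2; fun z => z.1.2; fun z => z.2].
  have H : computesb nv vs (fun z => mainN z.1.1.1 z.1.1.2 z.1.2 z.2).
    apply: (@computes_main _ nv vs (fun z => z.1.1.2) (fun z => z.1.2) (fun z => z.2)).
    + exact: (@computes_var _ nv vs 0).
    + exact: (@computes_var _ nv vs 1).
    + exact: (@computes_var _ nv vs 2).
  have [e We De] := H 5 [:: 1; 4; 2] 6 isT isT erefl.
  by exists e => // n l b x N w; rewrite (De (N, n, x, l)).
pose xes := [:: (0, ERead); (0, ERead); (1, e3); (3, e4); (3, e5); (5, e6)].
pose es := [seq xe.2 | xe <- xes].
pose code := compile_seq es 1 0.
pose P := code ++ [:: IConst 0 0; IAdd 0 0 6].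
pose C := (\sum_(e <- es) cst e) + 2; pose D := \max_(e <- es) dep e.
exists P, (C + 8 * D), (2 * D) => n G M k l cvdM Mk.
set T := _ * _.
pose b := 2 * n.+1 ^ 2.
pose x := \sum_(i < b) nth false (bits_of G M) i * 2 ^ i.
pose N := b * 2 ^ ((k * k + k) + (k * k + k)).
have bN : b <= N by rewrite leq_pmulr // expn_gt0.
have specM B : b <= B -> forall v : 'I_n, inMN B x v = (v \in M).
  move=> bB v; rewrite /inMN bitN_sum // bits_modulator.
  by rewrite (leq_trans (ltn_ord v)) // /b; nia.
have specG (u v : 'I_n) : adjN N n x u v = G u v.
  have := ltn_ord u; have := ltn_ord v => vn un.
  rewrite /adjN mulNE; last by apply: leq_trans bN; rewrite /b; nia.
  by rewrite bitN_sum // bits_adj; have -> : n + (u * n + v) < b by rewrite /b; nia.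
have nb : n <= b by rewrite /b; nia.
have kn : k <= n by rewrite -Mk -[X in _ <= X]card_ord max_card.
have bE : boundN b n x = N.
  have kb : k <= b by lia.
  have kkb : k * k + k + (k * k + k) <= b by have := leq_mul kn kn; rewrite /b; nia.
  rewrite /boundN (rankN_full nb (specM b (leqnn b))) Mk (mulNE _ kb) mulNE //.
  by rewrite (powNE kkb).
have main : mainN N n x l <-> dominator_colorable G l.
  apply: (main_correct cvdM (specM N bN) specG).
  - rewrite Mk; apply: (@leq_trans (2 ^ ((k * k + k) + (k * k + k)))).
      by rewrite leq_pexp2l //; nia.
    by rewrite /N leq_pmull // /b muln_gt0 expn_gt0.
  - rewrite Mk /N mulnC; apply: leq_mul; first by rewrite /b; nia.
    by rewrite leq_pexp2l //; nia.
  - by apply: leq_trans bN; rewrite /b; have := expn_gt0 n.+1 2; nia.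
have rd : den e4 [:: 0; n; l; b] [seq nat_of_bool c | c <- bits_of G M] =
    (x, (den e4 [:: 0; n; l; b] [seq nat_of_bool c | c <- bits_of G M]).2).
  rewrite [LHS]surjective_pairing d4; congr pair; apply: eq_bigr => i _.
  case: (ltnP i (size (bits_of G M))) => H; first by rewrite (nth_map false).
  by rewrite !nth_default ?size_map.
have e3E w : den e3 [:: 0; n; l] w = (b, w) by rewrite (d3 n) // square_boundE.
set w' := (den e4 _ _).2 in rd.
have run_es : (run_seq es [:: 0] (encode G M l)).1 =
    [:: 0; n; l; b; x; N; nat_of_bool (mainN N n x l)].
  by rewrite encodeE /es /xes /= e3E /= rd /= d5 bE /= d6.
have wf_es : wf_exprs N xes [:: 0] (encode G M l).
  rewrite encodeE /xes /= e3E /= rd /= d5 bE /= w3 w4 w5 w6 /= leqnn.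
  by rewrite bN (leq_trans nb bN).
have atP : code_at P 0 code by move=> i Hi; rewrite add0n onth_cat Hi.
have [//|r ag R] := @runs_seq P N xes 0 [:: 0] (encode G M l) atP wf_es (fun=> 0).
  by case.
rewrite run_es in ag.
pose final := Config (size code + 2) (upd (upd r 0 0) 0 (r 6))
  (run_seq es [:: 0] (encode G M l)).2.
have halt : halted P final by rewrite /halted size_cat.
have [t tT Et] : reaches P T (init (encode G M l)) final.
  apply: (@reaches_leq _ ((\sum_(e <- es) cst e) * N.+1 ^ D + 2)).
    apply: leq_trans (polynomial_bound C D k (input_size_encode G M l)).
    rewrite -/b -/N /C mulnDl leq_add2l -[X in X <= _]muln1 leq_mul2l.
    by rewrite expn_gt0.
  apply: reaches_trans R _; rewrite /final add0n addn2.
  apply: (@reaches_step _ _ (size code)) => //.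
    by rewrite /P onth_cat ltnn subnn.
  apply: (@reaches_step _ _ (size code).+1) => //.
    by rewrite /P onth_cat ltnNge leqnSn /= subSnn.
  exact: reaches_refl.
have fix_run j : iter j (step P) (iter t (step P) (init (encode G M l))) =
    iter t (step P) (init (encode G M l)).
  rewrite Et; elim: j => //= j ->; rewrite /step /=.
  by rewrite onth_default // size_cat.
rewrite /decides_within /run -(subnK tT) iterD fix_run Et; split=> //=.
by rewrite upd_same ag //= lt0b; apply: main.
Qed.
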